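(* Let $p\ge2$ and $q\ge2$ be integers, let $\omega(n)\to\infty$, and let $f(n)=n\,2^{-\omega(n)(\log n)^{1-1/q}}$. Then: (a) $$\overline{\rho\tau}\left(K_{pq},\mathbf{Q}(p,f)\right)\le\frac12\left(1-\frac{1}{q-1}\right).$$ (b) For every integer $i$ with $0\le i\le p-1$, let $t=\left\lfloor\frac{pq-i-1}{q-1}\right\rfloor$ (so $t\ge p$). If $g$ is a function such that, for all sufficiently large $n$, $$\mathbf{Q}\left(t+1,\frac{n}{q-1}\right)\le g(n)\le\mathbf{Q}\left(p,f(n)\right),$$ then $$\rho\tau\left(K_{pq-i},g\right)=\frac12\left(1-\frac{1}{q-1}\right).$$
   Context: All graphs are simple and logarithms are base $2$. For integers $t\ge2$, $\mathbf{Q}(t,n)$ is the minimum independence number over all $K_t$-free graphs on $n$ vertices. $\mathbf{Q}(p,f)$ denotes the function $n\mapsto\mathbf{Q}(p,f(n))$; floor and ceiling signs on non-integer arguments are omitted. For a graph $H$ and a function $f$, $\mathbf{RT}(n,H,f(n))$ denotes the maximum number of edges of an $H$-free graph on $n$ vertices with independence number less than $f(n)$ (taken to be $0$ if no such graph exists). Set $\overline{\rho\tau}(H,f)=\limsup_{n\to\infty}\mathbf{RT}(n,H,f(n))/n^2$ and $\underline{\rho\tau}(H,f)=\liminf_{n\to\infty}\mathbf{RT}(n,H,f(n))/n^2$; if these are equal, $\rho\tau(H,f)$ denotes the common value (and writing $\rho\tau(H,f)=c$ includes the assertion that it exists). The function $\omega$ is thought of as an arbitrary function tending to infinity slowly.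 *)

(* Defs.v *)
From HB Require Import structures.
From mathcomp Require Import all_boot all_order all_algebra.
From mathcomp Require Import all_classical all_reals all_analysis.
Set Implicit Arguments.
Unset Strict Implicit.
Unset Printing Implicit Defensive.
Import Order.TTheory GRing.Theory Num.Theory.
Import numFieldNormedType.Exports.
Local Open Scope ring_scope.

(* A simple graph on T is given by its set of edges, each a 2-subset of T. *)
Definition is_edge_set (T : finType) (E : {set {set T}}) : bool :=
  [forall e in E, #|e| == 2%N].

Definition sgraph (T : finType) : finType :=
  {E : {set {set T}} | is_edge_set E}.

Definition edges (T : finType) (G : sgraph T) : {set {set T}} := val G.

(* Irreflexive: for x = y the set [set x; y] has only one element. *)
Definition adj (T : finType) (G : sgraph T) : rel T :=
  fun x y => [set x; y] \in edges G.

Definition contains_copy (U T : finType) (H : sgraph U) (G : sgraph T) : bool :=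
  [exists f : {ffun U -> T},
     injectiveb f && [forall x, forall y, adj H x y ==> adj G (f x) (f y)]].

Definition graph_free (U T : finType) (H : sgraph U) (G : sgraph T) : bool :=
  ~~ contains_copy H G.

Definition independent (T : finType) (G : sgraph T) (S : {set T}) : bool :=
  [forall x in S, forall y in S, ~~ adj G x y].

Definition indep_num (T : finType) (G : sgraph T) : nat :=
  \max_(S : {set T} | independent G S) #|S|.

Fact complete_subproof (t : nat) :
  is_edge_set [set e : {set 'I_t} | #|e| == 2%N].
Proof. by apply/forall_inP => e; rewrite inE. Qed.

Definition complete (t : nat) : sgraph 'I_t :=
  exist _ [set e : {set 'I_t} | #|e| == 2%N] (complete_subproof t).

(* For t >= 2 the default value n of the minimum is attained, by the edgeless
   graph, so this is the minimum independence number of a K_t-free graph. *)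
Definition Qnum (t n : nat) : nat :=
  \big[minn/n]_(G : sgraph 'I_n | graph_free (complete t) G) indep_num G.

(* Q(t, x) for a real x >= 0, with non-integer arguments rounded up. *)
Definition Qreal (R : realType) (t : nat) (x : R) : nat :=
  Qnum t `|Num.ceil x|%N.

(* The maximum over the empty family is 0. *)
Definition RT (R : realType) (U : finType) (n : nat) (H : sgraph U) (m : R)
    : nat :=
  \max_(G : sgraph 'I_n | graph_free H G && ((indep_num G)%:R < m))
     #|edges G|.

Definition RTdensity (R : realType) (U : finType) (H : sgraph U)
    (f : nat -> R) (n : nat) : \bar R :=
  ((RT n H (f n))%:R / n%:R ^+ 2)%:E.

Definition rhotau_sup (R : realType) (U : finType) (H : sgraph U)
    (f : nat -> R) : \bar R := limn_esup (RTdensity H f).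

Definition rhotau_inf (R : realType) (U : finType) (H : sgraph U)
    (f : nat -> R) : \bar R := limn_einf (RTdensity H f).

(* "rho tau (H, f) exists and equals c" *)
Definition rhotau_is (R : realType) (U : finType) (H : sgraph U)
    (f : nat -> R) (c : R) : Prop :=
  rhotau_sup H f = c%:E /\ rhotau_inf H f = c%:E.

Definition log2 (R : realType) (x : R) : R := ln x / ln 2.

Definition fomega (R : realType) (q : nat) (omega : nat -> R) (n : nat) : R :=
  n%:R * 2 `^ (- (omega n * log2 (n%:R : R) `^ (1 - q%:R^-1))).

(* Main.v *)
(** Upper bound.  A graph with more than [(1 - 1/(q-1))/2 + eps] times [n^2]
    edges has [c n^q] copies of [K_q], by the Moon-Moser inequalities.  Write
    [s^q] for [log n].  Dependent random choice between the vertices and the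
    [k]-tuples spanning cliques turns a family of [2^(- a s^i) n^(k+1)] cliques
    into a large vertex set all of whose [p]-subsets have
    [2^(- a s^(i+1)) n^k] common [k]-tuples.  The set contains a [K_p], because
    the independence number is less than [Q(p, f)]; going on with the common
    tuples of this [K_p], one collects [q] copies of [K_p] forming a [K_pq].

    Lower bound.  Let [H] be extremal for [Q(t+1, n/(q-1))].  The join of
    [q-1] copies of [H] has too large an independence number by one, as the
    inequality in the definition of [RT] is strict.  But [H] is [K_2p]-free and
    its sets of order [f(n)] contain [K_p], so by the case [q = 2] of the argument
    above [H] is sparse; deleting two closed neighbourhoods of low degree
    vertices lowers its independence number by two at the cost of [o(n)]
    vertices.  The missing vertices are then added, as a further copy of a part
    of [H], in a way that raises the independence number by one only and does
    not create larger cliques (see [padded_join]). *)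
Require Import Defs.
From HB Require Import structures.
From mathcomp Require Import all_boot all_order all_algebra.
From mathcomp Require Import zify.
Set Implicit Arguments.
Unset Strict Implicit.
Unset Printing Implicit Defensive.

(** * Dependent random choice *)

Lemma leq_expl (m n e : nat) : m <= n -> m ^ e <= n ^ e.
Proof. by case: e => // e; rewrite leq_exp2r. Qed.

Lemma leq_bin_exp (n p : nat) : 'C(n, p) <= n ^ p.
Proof.
apply: (@leq_trans (n ^_ p)).
  by rewrite -bin_ffact leq_pmulr // fact_gt0.
elim: p n => [|p IHp] n; first by rewrite ffactn0.
case: n => [|n]; first by rewrite ffact0n.
rewrite ffactSS expnS leq_mul2l /=.
by apply: leq_trans (IHp n) _; rewrite leq_expl.
Qed.

(** Twice the difference of the two sides is the sum of [(d i - d j) * (d i ^ t - d j ^ t)] over all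
    pairs, and no term is negative. *)
Lemma chebyshev_sum (I : finType) (d : I -> nat) (t : nat) :
  (\sum_i d i) * (\sum_i d i ^ t) <= #|I| * \sum_i d i ^ t.+1.
Proof.
have swap : \sum_i \sum_j (d i * d j ^ t) = \sum_i \sum_j (d j * d i ^ t).
  exact: exchange_big.
have -> : (\sum_i d i) * (\sum_i d i ^ t) = \sum_i \sum_j (d i * d j ^ t).
  by rewrite big_distrl; apply: eq_bigr => i _; rewrite big_distrr.
have -> : #|I| * \sum_i d i ^ t.+1 = \sum_(i : I) \sum_j d j ^ t.+1.
  by rewrite sum_nat_const.
rewrite -leq_double -!addnn {1}swap [X in _ <= X + _]exchange_big /=.
rewrite -!big_split /=.
apply: leq_sum => i _; rewrite -!big_split; apply: leq_sum => j _.
rewrite /= !expnS.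
wlog le_ij : i j / d i <= d j => [wl|].
  have [/wl//|/ltnW/wl] := leqP (d i) (d j).
  by rewrite addnC [X in _ <= X]addnC.
have : d i ^ t <= d j ^ t by exact: leq_expl.
by move: (d i ^ t) (d j ^ t) => x y; nia.
Qed.

Lemma power_mean (I : finType) (d : I -> nat) (t : nat) :
  #|I| * (\sum_i d i) ^ t <= #|I| ^ t * \sum_i d i ^ t.
Proof.
elim: t => [|t IHt]; first by rewrite !expn0 sum1_card muln1 mul1n.
rewrite expnS mulnCA (leq_trans (leq_mul (leqnn _) IHt)) //.
by rewrite mulnCA expnSr -mulnA leq_mul2l chebyshev_sum orbT.
Qed.

(** [U] collects the vertices related to all of [t] random elements of [Y]. By convexity its
    expected order is at least [#|V| / D ^ t], hence above [m]. A [p]-set with too few common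
    elements lies in [U] with probability at most [1 / B ^ t], so the expected number of such sets
    is at most [1 / #|V|]. *)
Lemma dependent_random_choice (V Y : finType) (e : V -> Y -> bool)
    (p t m B D : nat) :
  0 < D -> 0 < m -> #|V| * #|Y| <= D * \sum_v #|[set y | e v y]| ->
  #|V| ^ p.+1 <= B ^ t -> m * D ^ t < #|V| ->
  exists2 U : {set V}, m <= #|U| &
    forall A : {set V}, A \subset U -> #|A| = p ->
      #|Y| <= B * #|[set y | [forall v in A, e v y]]|.
Proof.
move=> D_gt0 m_gt0 dense cardV ltm.
have [Y0|Y_gt0] := posnP #|Y|.
  exists [set: V] => [|A _ _]; last by rewrite Y0.
  by rewrite cardsT; apply: leq_trans (ltnW ltm); rewrite leq_pmulr // expn_gt0 D_gt0.
pose N (A : {set V}) := [set y | [forall v in A, e v y]].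
pose bad (A : {set V}) := (#|A| == p) && (B * #|N A| < #|Y|).
pose U (f : {ffun 'I_t -> Y}) := [set v | [forall i, e v (f i)]].
have cardF (P : pred Y) : #|[set f : {ffun 'I_t -> Y} | [forall i, P (f i)]]| = #|[set y | P y]| ^ t.
  rewrite -[t in RHS]card_ord -card_ffun_on; apply: eq_card => f.
  by rewrite inE; apply/forallP/ffun_onP => Pf i; have := Pf i; rewrite inE.
have card_sum (I J : finType) (r : I -> J -> bool) :
    \sum_i #|[set j | r i j]| = \sum_j #|[set i | r i j]|.
  under eq_bigr => i _ do (rewrite -sum1_card big_mkcond;
    under eq_bigr => j _ do rewrite inE).
  rewrite exchange_big; apply: eq_bigr => j _.
  by rewrite -sum1_card [RHS]big_mkcond; apply: eq_bigr => i _; rewrite inE.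
have sumU : \sum_f #|U f| = \sum_v #|[set y | e v y]| ^ t.
  by rewrite card_sum; apply: eq_bigr => v _; rewrite cardF.
pose F (A : {set V}) := [set f : {ffun 'I_t -> Y} | A \subset U f].
have cardFA A : #|F A| = #|N A| ^ t.
  rewrite -cardF; apply: eq_card => f; rewrite !inE.
  apply/subsetP/forallP => [sAU i|Af v Av].
    by apply/forall_inP => v /sAU; rewrite inE => /forallP.
  by rewrite inE; apply/forallP => i; move/forall_inP: (Af i); apply.
have V_gt0 : 0 < #|V| by apply: leq_ltn_trans ltm.
case: (pickP (fun f => (m <= #|U f|) && [forall (A | bad A), ~~ (A \subset U f)])).
  move=> f /andP[leU /forall_inP goodf]; exists (U f) => // A sAU cA.
  by rewrite leqNgt; apply/negP => ltN; move: (goodf A); rewrite /bad cA eqxx ltN sAU => /(_ isT).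
move=> nogood; exfalso.
(* A bad set inside [U f], weighted by [#|V|], pays for all of [U f]. Summed over [f], the 1 on the
   left matches the [#|Y| ^ t] that [leSb] allows on the right, so the strict [ltSd] gives the
   contradiction. *)
have stepU f : #|U f| + 1 <= m + #|V| * #|[set A | bad A && (A \subset U f)]|.
  have := nogood f; case: leqP => /= [leU|ltU _]; last first.
    by rewrite addn1 ltn_addr.
  move=> /negbT/forall_inPn[A badA]; rewrite negbK => sAU.
  have : 0 < #|[set A | bad A && (A \subset U f)]|.
    by apply/card_gt0P; exists A; rewrite inE sAU andbT.
  have : #|U f| <= #|V| by rewrite max_card.
  rewrite addnC => leUV bgt; apply: leq_add => //.
  by apply: leq_trans leUV _; rewrite leq_pmulr.
have : \sum_f (#|U f| + 1) <= \sum_f (m + #|V| * #|[set A | bad A && (A \subset U f)]|).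
  by apply: leq_sum => f _.
rewrite !big_split /= sumU -big_distrr /= !sum_nat_const !card_ffun card_ord muln1.
rewrite card_sum.
set Sd := \sum_v _; set Sb := \sum_A _ => le1.
have ltSd : m * #|Y| ^ t < Sd.
  rewrite -(@ltn_pmul2l (#|V| ^ t * D ^ t)) ?muln_gt0 ?expn_gt0 ?V_gt0 ?D_gt0 //.
  apply: (@leq_trans (#|V| * (#|V| * #|Y|) ^ t)).
    have -> : #|V| ^ t * D ^ t * (m * #|Y| ^ t) = m * D ^ t * (#|V| * #|Y|) ^ t.
      by rewrite expnMn; lia.
    by rewrite ltn_pmul2r // expn_gt0 muln_gt0 V_gt0 Y_gt0.
  apply: leq_trans (leq_mul (leqnn _) (leq_expl t dense)) _.
  rewrite expnMn mulnCA (mulnC (#|V| ^ t)) -mulnA leq_mul2l.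
  by rewrite power_mean orbT.
have leSb : #|V| * Sb <= #|Y| ^ t.
  have Bt_gt0 : 0 < B ^ t by apply: leq_trans cardV; rewrite expn_gt0 V_gt0.
  rewrite -(leq_pmul2l Bt_gt0).
  apply: (@leq_trans (#|V| * (#|V| ^ p * #|Y| ^ t))); last first.
    by rewrite mulnA -expnS leq_mul2r cardV orbT.
  rewrite mulnCA leq_mul2l; apply/orP; right.
  apply: (@leq_trans (\sum_(A : {set V} | #|A| == p) #|Y| ^ t)).
    rewrite /Sb big_distrr [X in _ <= X]big_mkcond /=; apply: leq_sum => A _.
    have [/andP[/eqP cA ltA]|nbA] := boolP (bad A); last first.
      have -> : #|[set f | false && (A \subset U f)]| = 0.
        by apply: eq_card0 => f; rewrite inE.
      by rewrite muln0.
    rewrite cA eqxx /= (cardFA A) -expnMn leq_expl //; exact: ltnW.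
  rewrite sum_nat_const leq_mul2r; apply/orP; right.
  apply: leq_trans (leq_bin_exp _ _).
  by rewrite -card_draws; apply: eq_leq; apply: eq_card => A; rewrite !inE.
move: le1; apply/negP; rewrite -ltnNge (mulnC _ m).
by apply: leq_ltn_trans (leq_add (leqnn _) leSb) _; rewrite ltn_add2r.
Qed.

(** * Cliques from dense families of tuples *)

Definition clique (T : finType) (e : rel T) (A : {set T}) : bool :=
  [forall x in A, forall y in A, (x != y) ==> e x y].

Lemma cliqueP (T : finType) (e : rel T) (A : {set T}) :
  reflect {in A &, forall x y, x != y -> e x y} (clique e A).
Proof.
apply: (iffP forall_inP) => [cA x y Ax Ay|cA x Ax].
  by move/implyP: (forall_inP (cA x Ax) y Ay).
by apply/forall_inP => y Ay; apply/implyP; exact: cA.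
Qed.

Lemma clique_sub (T : finType) (e : rel T) (A B : {set T}) :
  A \subset B -> clique e B -> clique e A.
Proof.
move=> /subsetP sAB /cliqueP cB; apply/cliqueP => x y /sAB Bx /sAB By.
exact: cB.
Qed.

Lemma cliqueU (T : finType) (e : rel T) (A B : {set T}) :
  symmetric e -> clique e A -> clique e B -> {in A & B, forall x y, e x y} ->
  clique e (A :|: B).
Proof.
move=> e_sym /cliqueP cA /cliqueP cB eAB; apply/cliqueP => x y.
rewrite !inE => /orP[Ax|Bx] /orP[Ay|By] neq; [exact: cA|exact: eAB| |exact: cB].
by rewrite e_sym; exact: eAB.
Qed.

Lemma subset_of_card (T : finType) (A : {set T}) (m : nat) :
  m <= #|A| -> exists2 B : {set T}, B \subset A & #|B| = m.
Proof.
move=> lemA.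
have : 0 < #|[set B : {set T} | B \subset A & #|B| == m]|.
  by rewrite cards_draws bin_gt0.
by case/card_gt0P => B; rewrite inE => /andP[sBA /eqP cB]; exists B.
Qed.

(** Induction on [k]: dependent random choice between first entries and tails yields a set holding a
    [p]-clique [A] with many common tails, and the induction continues in these. The last conclusion
    feeds the induction: every vertex of [C'] lies in a common tail of [A], so [A] and [C'] are
    completely joined. *)
Lemma drc_cliques (T : finType) (e : rel T) (p q s a m : nat) :
  symmetric e -> irreflexive e -> 0 < a -> 0 < m ->
  #|T| <= 2 ^ (s ^ q) -> m * 2 ^ (a * p.+1 * s ^ q.-1) < #|T| ->
  (forall U : {set T}, m <= #|U| ->
     exists A : {set T}, [/\ A \subset U, #|A| = p & clique e A]) ->
  forall (k : nat) (X : {set k.-tuple T}), k <= q ->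
    {in X, forall x : k.-tuple T, pairwise e x} ->
    #|T| ^ k <= 2 ^ (a * s ^ (q - k)) * #|X| ->
  exists C : {set T}, [/\ #|C| = p * k, clique e C &
    forall c, c \in C -> exists2 x, x \in X & c \in tval x].
Proof.
move=> e_sym e_irr a_gt0 m_gt0 leT ltm clT; elim=> [|k IHk] X lekq prX leX.
  exists set0; split; first by rewrite cards0 muln0.
    by apply/cliqueP => x y; rewrite inE.
  by move=> c; rewrite inE.
pose r (v : T) (y : k.-tuple T) := [tuple of v :: y] \in X.
have sum_r : \sum_v #|[set y | r v y]| = #|X|.
  under eq_bigr => v _ do rewrite -sum1_card big_mkcond.
  rewrite pair_big -sum1_card [RHS]big_mkcond /=.
  rewrite (reindex (fun x : k.+1.-tuple T => (thead x, [tuple of behead x]))) /=.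
    by apply: eq_bigr => x _; rewrite inE /r -tuple_eta.
  exists (fun vy : T * k.-tuple T => [tuple of vy.1 :: vy.2]) => [x _|[v y] _] /=.
    by rewrite -tuple_eta.
  by rewrite theadE; congr (_, _); apply: val_inj.
(* With [t = p.+1 * s ^ k], [B ^ t] is at least [#|T| ^ p.+1], and [D ^ t] does
   not depend on [k]. *)
have [U leU comU] : exists2 U : {set T}, m <= #|U| &
    forall A : {set T}, A \subset U -> #|A| = p ->
    #|{: k.-tuple T}| <= 2 ^ (a * s ^ (q - k)) * #|[set y | [forall v in A, r v y]]|.
  apply: (@dependent_random_choice _ _ _ _ (p.+1 * s ^ k) _ _ (2 ^ (a * s ^ (q - k.+1)))) => //.
  - by rewrite expn_gt0.
  - by rewrite sum_r card_tuple -expnS.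
  - apply: leq_trans (leq_expl p.+1 leT) _.
    rewrite -!expnM leq_pexp2l //.
    have -> : a * s ^ (q - k) * (p.+1 * s ^ k) = a * p.+1 * (s ^ (q - k) * s ^ k).
      by lia.
    by rewrite -expnD subnK ?(ltnW lekq) // (mulnC _ p.+1) leq_mul // leq_pmull.
  - rewrite -expnM.
    have -> : a * s ^ (q - k.+1) * (p.+1 * s ^ k) = a * p.+1 * (s ^ (q - k.+1) * s ^ k).
      by lia.
    by rewrite -expnD (_ : q - k.+1 + k = q.-1) //; lia.
have [A [sAU cA clA]] := clT U leU.
have := comU A sAU cA; rewrite card_tuple.
set X' := [set y | _] => leX'.
have rX' v y : v \in A -> y \in X' -> r v y.
  by move=> Av; rewrite inE => /forall_inP; exact.
have [v0 Av0|A0] := pickP (mem A); last first.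
  have p0 : p = 0 by rewrite -cA; apply: eq_card0.
  exists set0; split; first by rewrite cards0 p0.
    by apply/cliqueP => x y; rewrite inE.
  by move=> c; rewrite inE.
have [|C' [cC' clC' inC']] := IHk X' (ltnW lekq) _ leX'.
  by move=> y /(rX' _ _ Av0)/prX /=/andP[].
have eAC : {in A & C', forall x y, e x y}.
  move=> v c Av /inC'[y /(rX' _ _ Av)/prX /=/andP[/allP ev _]].
  exact: ev.
exists (A :|: C'); split.
- rewrite cardsU cA cC' (_ : A :&: C' = set0) ?cards0 ?subn0 ?mulnS //.
  apply/setP => c; rewrite !inE; apply/negP => /andP[Ac Cc].
  by have := eAC _ _ Ac Cc; rewrite e_irr.
- exact: cliqueU.
(* A vertex of [A] needs some tail to lie in a tuple of [X]; [X'] is nonempty since [#|T| ^ k] is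
   positive. *)
have [y X'y] : exists y, y \in X'.
  apply/card_gt0P; case: posnP leX' => // ->.
  by rewrite muln0 leqn0 expn_eq0 -leqn0 leqNgt (leq_ltn_trans _ ltm).
move=> c; rewrite inE => /orP[Ac|/inC'[z X'z cz]].
  by exists [tuple of c :: y]; [exact: rX'|rewrite inE eqxx].
by exists [tuple of v0 :: z]; [exact: rX'|rewrite inE cz orbT].
Qed.

(** * Counting cliques *)

Definition cliques (T : finType) (e : rel T) (r : nat) : {set {set T}} :=
  [set C : {set T} | (#|C| == r) && clique e C].

Definition common_nbrs (T : finType) (e : rel T) (A : {set T}) : {set T} :=
  [set w | [forall x in A, e x w]].

(** A clique [A] with a common neighbour [v] is the same as the clique [v |: A] with a marked
    vertex. The weight [F] lets this bijection serve both the first and the second moment of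
    [#|common_nbrs e A|]. *)
Lemma cliques_vertex_exchange (T : finType) (e : rel T) (r : nat)
    (F : {set T} -> nat) :
  symmetric e -> irreflexive e ->
  \sum_(A in cliques e r) \sum_(v in common_nbrs e A) F A
    = \sum_(C in cliques e r.+1) \sum_(v in C) F (C :\ v).
Proof.
move=> e_sym e_irr.
have notin v (A : {set T}) : v \in common_nbrs e A -> v \notin A.
  rewrite inE => /forall_inP eA; apply/negP => /eA.
  by rewrite e_irr.
rewrite !pair_big_dep /=.
rewrite (reindex_onto (fun x => (x.1 :\ x.2, x.2)) (fun x => (x.2 |: x.1, x.2))) /=.
  apply: eq_bigl => -[C v] /=; rewrite !inE; apply/idP/idP.
    case/andP=> /andP[/andP[/eqP cC clC] /forall_inP ev] /eqP[defC].
    have Cv : v \in C by rewrite -defC setU11.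
    rewrite Cv andbT; apply/andP; split.
      by rewrite (cardsD1 v) Cv cC.
    rewrite -defC; apply: cliqueU => // [|x y].
      by apply/cliqueP => x y; rewrite !inE => /eqP-> /eqP->; rewrite eqxx.
    by rewrite inE => /eqP-> /ev; rewrite e_sym.
  case/andP=> /andP[/eqP cC clC] Cv; rewrite setD1K // eqxx andbT.
  move: cC; rewrite (cardsD1 v) Cv add1n => -[->]; rewrite eqxx /=.
  rewrite (clique_sub _ clC) ?subsetDl //=; apply/forall_inP => x.
  rewrite !inE => /andP[neq Cx]; move/cliqueP: clC; exact.
move=> [A v] /= /andP[_ /notin Av]; congr (_, _).
by rewrite setU1K.
Qed.

Lemma sum_common_nbrs (T : finType) (e : rel T) (r : nat) :
  symmetric e -> irreflexive e ->
  \sum_(A in cliques e r) #|common_nbrs e A| = r.+1 * #|cliques e r.+1|.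
Proof.
move=> e_sym e_irr; have := cliques_vertex_exchange r (fun=> 1) e_sym e_irr.
under eq_bigr => A _ do rewrite sum1_card.
move=> ->; rewrite mulnC -sum_nat_const; apply: eq_bigr => C.
by rewrite sum1_card inE => /andP[/eqP-> _].
Qed.

Lemma cauchy_sum (I : finType) (A : {set I}) (d : I -> nat) :
  (\sum_(i in A) d i) ^ 2 <= #|A| * \sum_(i in A) d i ^ 2.
Proof.
have [A0|A_gt0] := posnP #|A|.
  by rewrite big1 ?exp0n // => i; rewrite (cards0_eq A0) inE.
rewrite [\sum_(i in A) d i]big_enum_val [\sum_(i in A) d i ^ 2]big_enum_val /= -(leq_pmul2l A_gt0).
have := power_mean (fun i : 'I_#|A| => d (enum_val i)) 2.
by rewrite card_ord -[#|A| ^ 2]mulnn -mulnA.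
Qed.

(* A vertex outside the common neighbourhood of a clique [C] is a common
   neighbour of [C :\ v] for at most one [v] in [C]. *)
Lemma sum_common_nbrsD1 (T : finType) (e : rel T) (C : {set T}) :
  \sum_(v in C) #|common_nbrs e (C :\ v)|
    <= #|T| + #|C|.-1 * #|common_nbrs e C|.
Proof.
under eq_bigr => v _ do rewrite -sum1_card big_mkcond /=.
rewrite exchange_big /=.
apply: (@leq_trans (\sum_w (1 + #|C|.-1 * (w \in common_nbrs e C)))); last first.
  rewrite big_split /= sum1_card -big_distrr /= leq_add2l leq_mul2l.
  apply/orP; right; rewrite -sum1_card [X in _ <= X]big_mkcond /=.
  by apply: leq_sum => w _; case: (_ \in _).
apply: leq_sum => w _; rewrite -big_mkcondr sum1_card /=.
have [Cw|] := boolP (w \in common_nbrs e C).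
  rewrite muln1 add1n; apply: leq_trans (leqSpred _); apply: subset_leq_card.
  by apply/subsetP => v /andP[].
rewrite inE muln0 addn0 => /forall_inPn[x Cx nexw].
rewrite -(cards1 x); apply: subset_leq_card; apply/subsetP => v.
rewrite !inE unfold_in => /andP[Cv]; rewrite inE => /forall_inP ev.
by apply: contraR nexw => neq; apply: ev; rewrite !inE eq_sym neq.
Qed.

(** Cauchy-Schwarz for the numbers of common neighbours of [r]-cliques. The exchange turns their sum
    of squares into a sum over cliques [C] of order [r.+1], where [sum_common_nbrsD1] bounds the
    contribution of the facets of [C]. *)
Lemma moon_moser (T : finType) (e : rel T) (r : nat) :
  symmetric e -> irreflexive e ->
  (r.+1 * #|cliques e r.+1|) ^ 2 <=
  #|cliques e r| *
    (#|T| * #|cliques e r.+1| + r * (r.+2 * #|cliques e r.+2|)).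
Proof.
move=> e_sym e_irr; rewrite -sum_common_nbrs //.
apply: leq_trans (cauchy_sum _ _) _; rewrite leq_mul2l; apply/orP; right.
have -> : \sum_(A in cliques e r) #|common_nbrs e A| ^ 2 =
    \sum_(A in cliques e r) \sum_(v in common_nbrs e A) #|common_nbrs e A|.
  by apply: eq_bigr => A _; rewrite sum_nat_const.
rewrite (cliques_vertex_exchange r (fun A => #|common_nbrs e A|)) //.
rewrite -(sum_common_nbrs r.+1) // big_distrr /= mulnC -sum_nat_const -big_split /=.
apply: leq_sum => C; rewrite inE => /andP[/eqP cC _].
by have := sum_common_nbrsD1 e C; rewrite cC.
Qed.

Lemma cliques1 (T : finType) (e : rel T) : cliques e 1 = [set [set x] | x in T].
Proof.
apply/setP => C; rewrite inE.
apply/andP/imsetP => [[/cards1P[x ->] _]|[x _ ->]]; first by exists x.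
rewrite cards1; split=> //; apply/cliqueP => y z.
by rewrite !inE => /eqP-> /eqP->; rewrite eqxx.
Qed.

Lemma card_cliques1 (T : finType) (e : rel T) : #|cliques e 1| = #|T|.
Proof. by rewrite cliques1 card_imset //; exact: set1_inj. Qed.

Lemma sum_degrees (T : finType) (e : rel T) : symmetric e -> irreflexive e ->
  \sum_x #|[set y | e x y]| = 2 * #|cliques e 2|.
Proof.
move=> e_sym e_irr; rewrite -(sum_common_nbrs 1) // cliques1.
rewrite big_imset /=; last by move=> x y _ _; exact: set1_inj.
apply: eq_bigr => x _; apply: eq_card => y; rewrite !inE.
apply/idP/forall_inP => [exy z|]; first by rewrite inE => /eqP->.
by apply; rewrite inE.
Qed.

(** * Graphs on ordinals *)

Lemma adj_sym (T : finType) (G : sgraph T) : symmetric (adj G).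
Proof. by move=> x y; rewrite /adj setUC. Qed.

Lemma card_edge (T : finType) (G : sgraph T) (C : {set T}) :
  C \in edges G -> #|C| = 2.
Proof. by move=> GC; apply/eqP/(forall_inP (valP G)). Qed.

Lemma adj_irr (T : finType) (G : sgraph T) : irreflexive (adj G).
Proof. by move=> x; apply/negP => /card_edge; rewrite setUid cards1. Qed.

Lemma edges_cliques (T : finType) (G : sgraph T) : edges G = cliques (adj G) 2.
Proof.
apply/setP => C; rewrite inE; apply/idP/andP => [GC|[]].
  have cC := card_edge GC; rewrite cC eqxx; split=> //.
  move/eqP/cards2P : cC GC => [x [y [_ ->]]] GC; apply/cliqueP => z w.
  rewrite !inE => /orP[]/eqP-> /orP[]/eqP->; rewrite ?eqxx // => _.
  by rewrite adj_sym.
case/cards2P => x [y [neq ->]] /cliqueP; apply => //; by rewrite !inE eqxx ?orbT.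
Qed.

Lemma contains_completeP (T : finType) (G : sgraph T) (t : nat) :
  reflect (exists2 C : {set T}, #|C| = t & clique (adj G) C)
          (contains_copy (complete t) G).
Proof.
have adjK (i j : 'I_t) : adj (complete t) i j = (i != j).
  by rewrite /adj inE cards2; case: (i != j).
apply: (iffP existsP) => [[f /andP[/injectiveP f_inj /forallP fP]]|[C cC clC]].
  exists (f @: setT); first by rewrite card_imset // cardsT card_ord.
  apply/cliqueP => _ _ /imsetP[i _ ->] /imsetP[j _ ->] neq.
  move/forallP: (fP i) => /(_ j)/implyP; apply.
  by rewrite adjK; apply: contra_neq neq => ->.
exists [ffun i : 'I_t => enum_val (cast_ord (esym cC) i)].
have f_inj : injective (fun i : 'I_t => enum_val (cast_ord (esym cC) i)).
  by move=> i j /enum_val_inj/cast_ord_inj.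
apply/andP; split.
  by apply/injectiveP => i j; rewrite !ffunE => /f_inj.
apply/forallP => i; apply/forallP => j; rewrite adjK !ffunE; apply/implyP => neq.
move/cliqueP: clC; apply; rewrite ?enum_valP //.
by apply: contra_neq neq => /f_inj.
Qed.

Lemma graph_of_rel (T : finType) (r : rel T) :
  symmetric r -> irreflexive r -> exists G : sgraph T, adj G =2 r.
Proof.
move=> r_sym r_irr.
pose E := [set C : {set T} | [exists x, exists y, (C == [set x; y]) && r x y]].
have EP : is_edge_set E.
  apply/forall_inP => C; rewrite inE => /existsP[x /existsP[y /andP[/eqP-> rxy]]].
  by rewrite cards2; case: (eqVneq x y) rxy => [->|//]; rewrite r_irr.
exists (exist _ E EP) => x y; rewrite /adj /edges /= inE.
apply/existsP/idP => [[z /existsP[w /andP[/eqP eqC rzw]]]|rxy]; last first.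
  by exists x; apply/existsP; exists y; rewrite eqxx.
have: z \in [set x; y] by rewrite eqC set21.
have: w \in [set x; y] by rewrite eqC set22.
have: x \in [set z; w] by rewrite -eqC set21.
have: y \in [set z; w] by rewrite -eqC set22.
rewrite !inE.
by do 4![case/orP=> /eqP ?; subst]; rewrite // 1?r_sym //; move: rzw; rewrite ?r_irr.
Qed.

(** [Qnum] and [RT] range over graphs on ordinals only; induced subgraphs and constructions on other
    types are carried there by enumerating [D]. *)
Lemma pullback_graph (W : finType) (e : rel W) (D : {set W}) (n : nat) :
  symmetric e -> irreflexive e -> #|D| = n ->
  exists (G : sgraph 'I_n) (f : 'I_n -> W),
    [/\ injective f, f @: setT = D & forall x y, adj G x y = e (f x) (f y)].
Proof.
move=> e_sym e_irr cD.
pose f (i : 'I_n) : W := enum_val (cast_ord (esym cD) i).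
have [G GP] := @graph_of_rel 'I_n (relpre f e) (fun x y => e_sym _ _) (fun x => e_irr _).
exists G, f; split=> //; first by move=> i j /enum_val_inj/cast_ord_inj.
apply/setP => w; apply/imsetP/idP => [[i _ ->]|Dw]; first exact: enum_valP.
exists (cast_ord cD (enum_rank_in Dw w)) => //.
by rewrite /f cast_ordK enum_rankK_in.
Qed.

Lemma indep_num_ge (T : finType) (G : sgraph T) (S : {set T}) :
  independent G S -> #|S| <= indep_num G.
Proof. exact: leq_bigmax_cond. Qed.

Lemma indep_num_attained (T : finType) (G : sgraph T) :
  exists2 S : {set T}, independent G S & #|S| = indep_num G.
Proof.
have S0 : independent G set0 by apply/forall_inP => x; rewrite inE.
have : 0 < #|[pred S : {set T} | independent G S]| by apply/card_gt0P; exists set0.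
by case/(eq_bigmax_cond (fun S : {set T} => #|S|)) => S GS eqS; exists S.
Qed.

Lemma Qnum_le (t n : nat) (G : sgraph 'I_n) :
  graph_free (complete t) G -> Qnum t n <= indep_num G.
Proof.
rewrite /Qnum -minEnat => freeG.
exact: (Order.TotalTheory.bigmin_le_cond n (@indep_num 'I_n) freeG).
Qed.

Lemma Qnum_attained (t n : nat) : 1 < t ->
  exists2 G : sgraph 'I_n, graph_free (complete t) G & indep_num G = Qnum t n.
Proof.
move=> t_gt1; rewrite /Qnum.
have [E EP] := @graph_of_rel 'I_n (fun _ _ => false) (fun _ _ => erefl) (fun _ => erefl).
have freeE : graph_free (complete t) E.
  apply/contains_completeP => -[C cC /cliqueP clC]; move: t_gt1; rewrite -cC.
  case/card_gt1P => x [y [Cx Cy neq]].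
  by have := clC _ _ Cx Cy neq; rewrite EP.
have indE : indep_num E = n.
  apply/eqP; rewrite eqn_leq; apply/andP; split.
    by have [S _ <-] := indep_num_attained E; rewrite -[X in _ <= X]card_ord max_card.
  rewrite -[X in X <= _]card_ord -cardsT; apply: indep_num_ge.
  by apply/forall_inP => x _; apply/forall_inP => y _; rewrite EP.
apply: (big_ind (fun x => exists2 G : sgraph 'I_n, graph_free (complete t) G & indep_num G = x)).
- by exists E.
- move=> x y [G freeG <-] [H freeH <-].
  by rewrite /minn; case: ifP => _; [exists G|exists H].
- by move=> G freeG; exists G.
Qed.

Lemma Qnum_rel (T : finType) (e : rel T) (p : nat) (U : {set T}) :
  symmetric e -> irreflexive e ->
  (forall A : {set T}, A \subset U -> clique e A -> #|A| <> p) ->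
  exists S : {set T}, [/\ S \subset U, Qnum p #|U| <= #|S| &
    {in S &, forall x y, ~~ e x y}].
Proof.
move=> e_sym e_irr noclique.
have [G [f [f_inj imf GP]]] := pullback_graph e_sym e_irr (erefl #|U|).
have fU x : f x \in U by rewrite -imf imset_f.
have sub (A : {set 'I_#|U|}) : f @: A \subset U.
  by apply/subsetP => _ /imsetP[x _ ->].
have freeG : graph_free (complete p) G.
  apply/contains_completeP => -[C cC /cliqueP clC].
  apply: (noclique (f @: C)); rewrite ?card_imset //.
  apply/cliqueP => _ _ /imsetP[x Cx ->] /imsetP[y Cy ->] neq.
  by rewrite -GP; apply: clC => //; apply: contra_neq neq => ->.
have [S GS cS] := indep_num_attained G.
exists (f @: S); split=> //; first by rewrite card_imset // cS Qnum_le.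
move=> _ _ /imsetP[x Sx ->] /imsetP[y Sy ->]; rewrite -GP.
by move/forall_inP: GS => /(_ x Sx)/forall_inP; apply.
Qed.

(** This is [drc_cliques] started at [k = q], where the density loss [2 ^ (a * s ^ (q - k))] is the
    constant [2 ^ a]. *)
Lemma clique_multiple (T : finType) (e : rel T) (p q s a m : nat) :
  symmetric e -> irreflexive e -> 0 < a -> 0 < m ->
  #|T| <= 2 ^ (s ^ q) -> m * 2 ^ (a * p.+1 * s ^ q.-1) < #|T| ->
  (forall U : {set T}, m <= #|U| ->
     exists A : {set T}, [/\ A \subset U, #|A| = p & clique e A]) ->
  #|T| ^ q <= 2 ^ a * #|cliques e q| ->
  exists2 C : {set T}, #|C| = p * q & clique e C.
Proof.
move=> e_sym e_irr a_gt0 m_gt0 leT ltm clT many.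
pose X := [set x : q.-tuple T | pairwise e x].
have [|||C [cC clC _]] := drc_cliques e_sym e_irr a_gt0 m_gt0 leT ltm clT (k := q) (X := X) => //.
- by move=> x; rewrite inE.
(* Each [q]-clique is the set of entries of its enumeration, so there are at least as many tuples in
   [X] as cliques. *)
- apply: leq_trans many _; rewrite subnn expn0 muln1 leq_mul2l; apply/orP; right.
  apply: leq_trans (leq_imset_card (fun x : q.-tuple T => [set y in x]) X).
  apply: subset_leq_card; apply/subsetP => C; rewrite inE => /andP[/eqP cC /cliqueP clC].
  have sC : size (enum C) == q by rewrite -cardE cC.
  apply/imsetP; exists (Tuple sC); last by apply/setP => y; rewrite inE mem_enum.
  rewrite inE /=; have := enum_uniq C; rewrite uniq_pairwise.
  apply: (@sub_in_pairwise _ (mem C)); first exact: clC.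
  by apply/allP => x; rewrite mem_enum.
by exists C.
Qed.

Lemma small_indep_clique (T : finType) (G : sgraph T) (p m : nat) (U : {set T}) :
  indep_num G < Qnum p m -> m <= #|U| ->
  exists A : {set T}, [/\ A \subset U, #|A| = p & clique (adj G) A].
Proof.
move=> ltQ /subset_of_card[V sVU cV].
have [/existsP[A /and3P[sAV /eqP cA clA]]|/existsPn noclique] :=
  boolP [exists A : {set T}, [&& A \subset V, #|A| == p & clique (adj G) A]].
  by exists A; rewrite (subset_trans sAV).
have [|S [sSV leS indS]] := @Qnum_rel T (adj G) p V (@adj_sym _ G) (@adj_irr _ G).
  by move=> A sAV clA cA; have := noclique A; rewrite sAV cA eqxx clA.
have : #|S| <= indep_num G.
  by apply: indep_num_ge; apply/forall_inP => x Sx; apply/forall_inP => y; exact: indS.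
by move=> leS'; have := leq_trans leS leS'; rewrite cV leqNgt ltQ.
Qed.

(** * Lowering the independence number *)

Lemma cliqueU1 (T : finType) (e : rel T) (v : T) (A : {set T}) :
  symmetric e -> clique e A -> {in A, forall x, e v x} -> clique e (v |: A).
Proof.
move=> e_sym clA evA; apply: cliqueU => // [|x y].
  by apply/cliqueP => x y; rewrite !inE => /eqP-> /eqP->; rewrite eqxx.
by rewrite inE => /eqP-> /evA.
Qed.

(* If every [m]-set without a [p]-clique has an independent set of maximum size
   [k], then the non-neighbours of [w] in a set without a [p]-clique are fewer
   than [m], since [w] extends their independent sets. *)
Lemma clique_in_large_set (T : finType) (e : rel T) (p m k : nat) :
  symmetric e -> irreflexive e -> 0 < p ->
  (forall S : {set T}, {in S &, forall x y, ~~ e x y} -> #|S| <= k) ->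
  (forall U : {set T}, m <= #|U| ->
     (forall A : {set T}, A \subset U -> clique e A -> #|A| <> p) ->
     exists S : {set T}, [/\ S \subset U, k <= #|S| &
       {in S &, forall x y, ~~ e x y}]) ->
  forall U : {set T}, p.-1 * m < #|U| ->
    exists A : {set T}, [/\ A \subset U, #|A| = p & clique e A].
Proof.
move=> e_sym e_irr p_gt0 indk mk U ltU.
suff [A [sAU leA clA]] : exists A : {set T}, [/\ A \subset U, p <= #|A| & clique e A].
  have [B sBA cB] := subset_of_card leA.
  by exists B; split=> //; [exact: subset_trans sAU|exact: clique_sub clA].
suff main (j : nat) : j < p -> forall U : {set T}, j * m < #|U| ->
    exists A : {set T}, [/\ A \subset U, j < #|A| & clique e A].
  by have [|A [sAU leA clA]] := main p.-1 _ U ltU; [lia|exists A; split=> //; lia].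
elim: j => [_|j IHj ltjp] {ltU}U ltU.
  have /card_gt0P[v Uv] : 0 < #|U| by lia.
  exists [set v]; rewrite sub1set cards1; split=> //.
  by apply/cliqueP => x y; rewrite !inE => /eqP-> /eqP->; rewrite eqxx.
have /card_gt0P[w Uw] : 0 < #|U| by lia.
pose N := U :&: [set x | e w x]; pose M := (U :\ w) :\: N.
have cU : #|U| = #|N| + #|M| + 1.
  rewrite (cardsD1 w) Uw addnC; congr (_ + _).
  rewrite -(cardsID N (U :\ w)); congr (#|pred_of_set _| + _).
  apply/setP => x; rewrite !inE; case: (eqVneq x _) => [->|_] /=; last by case: (x \in _).
  by rewrite e_irr andbF.
have [leM|ltM] := leqP m #|M|; last first.
  have [||A [sAN ltA clA]] := IHj _ N; [exact: ltnW|by move: ltU; rewrite cU; lia|].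
  have eA x : x \in A -> e w x by move/(subsetP sAN); rewrite !inE => /andP[].
  exists (w |: A); split; last exact: cliqueU1.
    rewrite subUset sub1set Uw (subset_trans sAN) //; exact: subsetIl.
  rewrite cardsU1 (_ : w \notin A) ?add1n //.
  by apply/negP => /eA; rewrite e_irr.
have [/existsP[A /and3P[sAM /eqP cA clA]]|/existsPn noclique] :=
  boolP [exists A : {set T}, [&& A \subset M, #|A| == p & clique e A]].
  exists A; split=> //; last by rewrite cA.
  by apply: subset_trans sAM _; rewrite subDset; apply/subsetU/orP; right; exact: subD1set.
have [|S [sSM leS indS]] := mk M leM.
  by move=> A sAM clA cA; have := noclique A; rewrite sAM cA eqxx clA.
have nS x : x \in S -> (x != w) && ~~ e w x.
  by move/(subsetP sSM); rewrite !inE => /andP[+ /andP[-> Ux]]; rewrite Ux.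
have : #|w |: S| <= k.
  apply: indk => x y; rewrite !inE => /orP[/eqP->|Sx] /orP[/eqP->|Sy].
  - by rewrite e_irr.
  - by case/andP: (nS y Sy).
  - by rewrite e_sym; case/andP: (nS x Sx).
  - exact: indS.
rewrite cardsU1 (_ : w \notin S) ?add1n; first by lia.
by apply/negP => /nS; rewrite eqxx.
Qed.

(** Otherwise [A] spans at least [#|A| ^ 2 / D] ordered adjacent pairs, a proportion of at least
    [1 / (4 * D)] of all pairs because [A] is at least half of [T]; then [drc_cliques] with [q = 2]
    finds a clique of order [p * 2]. *)
Lemma low_degree_vertex (T : finType) (e : rel T) (p s a m D : nat) (A : {set T}) :
  symmetric e -> irreflexive e -> 0 < a -> 0 < m ->
  #|T| <= 2 ^ (s ^ 2) -> m * 2 ^ (a * p.+1 * s) < #|T| ->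
  (forall U : {set T}, m <= #|U| ->
     exists B : {set T}, [/\ B \subset U, #|B| = p & clique e B]) ->
  (forall C : {set T}, clique e C -> #|C| <> p * 2) ->
  4 * D <= 2 ^ a -> #|T| <= 2 * #|A| ->
  exists2 v, v \in A & D * #|A :&: [set w | e v w]| < #|A|.
Proof.
move=> e_sym e_irr a_gt0 m_gt0 leT ltm clT noclique leD leA.
have [/exists_inP//|/exists_inPn dense] :=
  boolP [exists v in A, D * #|A :&: [set w | e v w]| < #|A|].
exfalso.
pose X := [set x : 2.-tuple T | [&& tnth x ord0 \in A, tnth x ord_max \in A & e (tnth x ord0) (tnth x ord_max)]].
have [||||C [cC clC _]] := drc_cliques e_sym e_irr a_gt0 m_gt0 leT _ clT (k := 2) (X := X) => //.
- move=> x; rewrite inE => /and3P[_ _].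
  case: x => -[|x [|y []]] //= sx.
  by rewrite /tnth /= => ->.
- have sumX : \sum_(v in A) #|A :&: [set w | e v w]| <= #|X|.
    have -> : \sum_(v in A) #|A :&: [set w | e v w]| =
        \sum_(v in A) \sum_(w in A :&: [set w | e v w]) 1.
      by apply: eq_bigr => v _; rewrite sum1_card.
    rewrite pair_big_dep -sum1_card /=.
    rewrite [X in _ <= X](reindex (fun x : T * T => [tuple x.1; x.2])) /=.
      rewrite big_mkcond [X in _ <= X]big_mkcond; apply: leq_sum => -[v w] _.
      by rewrite !inE /tnth.
    exists (fun x : 2.-tuple T => (tnth x ord0, tnth x ord_max)) => [[v w] _|x _] //.
    by apply/val_inj; case: x => -[|x [|y []]].
  have leAX : #|A| * #|A| <= D * #|X|.
    apply: leq_trans (leq_mul (leqnn D) sumX).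
    rewrite big_distrr /= -sum_nat_const; apply: leq_sum => v Av.
    by rewrite leqNgt dense.
  rewrite subnn expn0 muln1 -mulnn.
  apply: (@leq_trans (4 * D * #|X|)); last by rewrite leq_mul2r leD orbT.
  apply: leq_trans (leq_mul leA leA) _; lia.
exact: (noclique C clC).
Qed.

Lemma delete_closed_nbhd (T : finType) (e : rel T) (A S : {set T}) (v : T) :
  symmetric e -> irreflexive e -> v \in A ->
  S \subset (A :\ v) :\: [set w | e v w] -> {in S &, forall x y, ~~ e x y} ->
  exists2 S' : {set T}, S' \subset A /\ {in S' &, forall x y, ~~ e x y} &
    #|S'| = #|S|.+1.
Proof.
move=> e_sym e_irr Av sS indS; exists (v |: S); last first.
  rewrite cardsU1 (_ : v \notin S) //.
  by apply/negP => /(subsetP sS); rewrite !inE eqxx andbF.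
have nS x : x \in S -> (x \in A) && ~~ e v x.
  by move/(subsetP sS); rewrite !inE => /and3P[-> _ ->].
split; first by rewrite subUset sub1set Av; apply/subsetP => x /nS/andP[].
move=> x y; rewrite !inE => /orP[/eqP->|Sx] /orP[/eqP->|Sy].
- by rewrite e_irr.
- by case/andP: (nS y Sy).
- by rewrite e_sym; case/andP: (nS x Sx).
- exact: indS.
Qed.

(* Deleting the closed neighbourhood of a vertex lowers the independence number
   by one, and low degree vertices make this cheap. *)
Lemma lower_indep_by_two (T : finType) (e : rel T) (p s a m D k : nat) :
  symmetric e -> irreflexive e -> 0 < a -> 0 < m ->
  #|T| <= 2 ^ (s ^ 2) -> m * 2 ^ (a * p.+1 * s) < #|T| ->
  (forall U : {set T}, m <= #|U| ->
     exists B : {set T}, [/\ B \subset U, #|B| = p & clique e B]) ->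
  (forall C : {set T}, clique e C -> #|C| <> p * 2) ->
  4 * D <= 2 ^ a -> 4 <= D -> 4 <= #|T| ->
  (forall S : {set T}, {in S &, forall x y, ~~ e x y} -> #|S| <= k) ->
  exists A : {set T}, [/\ #|A| + 2 <= #|T|, D * #|T| <= D * #|A| + 2 * D + 2 * #|T| &
    forall S : {set T}, S \subset A -> {in S &, forall x y, ~~ e x y} -> #|S| + 2 <= k].
Proof.
move=> e_sym e_irr a_gt0 m_gt0 leT ltm clT noclique leD D_ge4 T_ge4 indk.
have low A := low_degree_vertex (A := A) e_sym e_irr a_gt0 m_gt0 leT ltm clT noclique leD.
pose del (A : {set T}) v := (A :\ v) :\: [set w | e v w].
have cdel (A : {set T}) v : v \in A -> #|A| = #|A :&: [set w | e v w]| + #|del A v| + 1.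
  move=> Av; rewrite (cardsD1 v) Av addnC; congr (_ + _).
  rewrite -(cardsID [set w | e v w] (A :\ v)); congr (#|pred_of_set _| + _).
  apply/setP => x; rewrite !inE; case: (eqVneq x _) => [->|_] /=; last by case: (x \in _).
  by rewrite e_irr andbF.
have [|v _ ltv] := low setT; first by rewrite cardsT; lia.
have cv := cdel setT v (in_setT v).
set A1 := del setT v in cv; rewrite cardsT in ltv cv.
have aux x y c N : c = x + y + 1 -> D * x < N -> D * c <= D * y + D + N.
  by move=> ->; rewrite !mulnDr; lia.
have leA1 : D * #|T| <= D * #|A1| + D + #|T|.
  exact: aux cv ltv.
have A1T : #|A1| <= #|T| := max_card _.
(* The bounds [4 <= D] and [4 <= #|T|] ensure that [A1] is still at least half of [T]. *)
have [|w A1w ltw] := low A1; first by nia.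
have cw := cdel A1 w A1w.
set A2 := del A1 w in cw.
exists A2; split.
- by lia.
- by have := aux _ _ _ _ cw ltw; lia.
move=> S sS indS.
have [S1 [sS1 indS1] cS1] := delete_closed_nbhd e_sym e_irr A1w sS indS.
have [S2 [_ indS2] cS2] := delete_closed_nbhd e_sym e_irr (in_setT v) sS1 indS1.
by have := indk S2 indS2; lia.
Qed.

(** * A dense graph with small clique and independence numbers *)

(* Besides the copies of [e] indexed by [I], completely joined for the most part,
   [f] indexes a filler copy: [(f, h)] is adjacent to the other vertices over [h]
   and, among the vertices indexed by [i0] and [i1], to those over the neighbours
   of [h]; to compensate, [(i0, h)] and [(i1, h)] are not adjacent.  If [C0],
   [C1] and [Cf] are the three parts of a clique, then [C0 :|: Cf] and
   [C1 :|: Cf] are cliques of [e] and [C0], [C1] are disjoint, so that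
   [#|C0| + #|C1| + #|Cf|] is at most twice the clique number of [e].  An
   independent set projects onto an independent set of [e], with at most one
   fibre of size two. *)
Definition padded_join (I T : finType) (e : rel T) (i0 i1 f : I) :
    rel (I * T) :=
  fun x y =>
  if x.1 == y.1 then e x.2 y.2
  else if (x.1 \in pred2 i0 i1) && (y.1 \in pred2 i0 i1) then x.2 != y.2
  else if (x.1 \in pred3 i0 i1 f) && (y.1 \in pred3 i0 i1 f)
    then (x.2 == y.2) || e x.2 y.2
  else true.

Section PaddedJoin.
Variables (I T : finType) (e : rel T) (i0 i1 f : I).
Hypotheses (e_sym : symmetric e) (e_irr : irreflexive e).
Hypotheses (neq01 : i0 != i1) (neq0f : i0 != f) (neq1f : i1 != f).

Local Notation r := (padded_join e i0 i1 f).

Lemma padded_join_sym : symmetric r.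
Proof.
move=> x y; rewrite /padded_join eq_sym (eq_sym x.2) e_sym.
by rewrite ![(x.1 \in _) && _]andbC.
Qed.

Lemma padded_join_irr : irreflexive r.
Proof. by move=> x; rewrite /padded_join eqxx e_irr. Qed.

Lemma padded_join_adj (x y : I * T) : e x.2 y.2 -> r x y.
Proof.
rewrite /padded_join => exy; rewrite exy orbT; case: ifP => // _.
case: ifP => _; last by case: ifP.
by apply: contraTneq exy => ->; rewrite e_irr.
Qed.

Lemma padded_join_nonadj (x y : I * T) : x != y -> x.2 = y.2 -> ~~ r x y ->
  (x.1 == i0) && (y.1 == i1) || (x.1 == i1) && (y.1 == i0).
Proof.
case: x y => [i h] [j h'] /= neqx eqh; move: neqx.
rewrite -{h'}eqh /padded_join /= eqxx /=.
case: (eqVneq i j) => [->|neq _]; first by rewrite eqxx.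
case: ifP => [/andP[]|]; last by case: ifP.
rewrite !inE => /orP[]/eqP ei /orP[]/eqP ej _; move: neq; rewrite ei ej ?eqxx //.
by rewrite orbT.
Qed.

Lemma padded_join_indep (S : {set I * T}) :
  {in S &, forall x y, ~~ r x y} ->
  {in [set x.2 | x in S] &, forall h h', ~~ e h h'} /\
  #|S| <= #|[set x.2 | x in S]|.+1.
Proof.
move=> indS; split.
  move=> _ _ /imsetP[x Sx ->] /imsetP[y Sy ->].
  by apply: contra (indS x y Sx Sy); exact: padded_join_adj.
have clash x y : x \in S -> y \in S -> x.2 = y.2 -> x != y ->
    exists2 h, (i0, h) \in S /\ (i1, h) \in S & h = x.2.
  move=> Sx Sy eq2 neq; have := padded_join_nonadj neq eq2 (indS x y Sx Sy).
  case: x y Sx Sy eq2 {neq} => [i h] [j h'] /= Sx Sy eqh.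
  rewrite -{h'}eqh in Sy *.
  by case/orP=> /andP[/eqP ei /eqP ej]; exists h => //; rewrite -ei -ej.
have [/existsP[h0 /andP[S0 S1]]|/existsPn noclash] :=
  boolP [exists h, ((i0, h) \in S) && ((i1, h) \in S)]; last first.
  apply: leqW; rewrite card_in_imset // => x y Sx Sy eq2.
  apply/eqP/negPn/negP => /(clash x y Sx Sy eq2)[h [S0 S1] _].
  by have := noclash h; rewrite S0 S1.
(* Vertices over [i0] and [i1] with distinct second coordinates are adjacent, so [h0] has the only
   double fibre; removing [(i1, h0)] makes the projection injective. *)
have uniq1 h : (i1, h) \in S -> h = h0.
  move=> Sh; have := indS _ _ S0 Sh; rewrite /padded_join /= (negPf neq01).
  by rewrite !inE !eqxx orbT /= negbK => /eqP.
rewrite (cardsD1 (i1, h0)) S1 add1n ltnS.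
apply: (@leq_trans #|[set x.2 | x in S :\ (i1, h0)]|); last first.
  by apply/subset_leq_card/imsetS/subsetDl.
rewrite card_in_imset // => x y; rewrite !inE => /andP[nx Sx] /andP[ny Sy] eq2.
apply/eqP/negPn/negP => neq.
have := padded_join_nonadj neq eq2 (indS x y Sx Sy).
case: x y nx ny Sx Sy eq2 {neq} => [i h] [j h'] /= nx ny Sx Sy eq2.
case/orP=> /andP[/eqP ei /eqP ej].
  by move: ny Sy; rewrite ej => + /uniq1 eh; rewrite eh eqxx.
by move: nx Sx; rewrite ei => + /uniq1 eh; rewrite eh eqxx.
Qed.

Lemma padded_join_clique (t : nat) (C : {set I * T}) :
  (forall B : {set T}, clique e B -> (B \subset [set x.2 | x in C]) -> #|B| <= t) ->
  clique r C -> #|C| <= #|I|.-1 * t.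
Proof.
move=> omega_t /cliqueP clC.
pose L i := [set h | (i, h) \in C].
have cC : #|C| = \sum_i #|L i|.
  under eq_bigr => i _ do rewrite -sum1_card.
  rewrite pair_big_dep -sum1_card; apply: eq_bigl => -[i h] /=.
  by rewrite inE.
have inL i h : h \in L i -> h \in [set x.2 | x in C].
  by rewrite inE => Cih; apply/imsetP; exists (i, h).
(* The condition admits [i = j] and the pairs of [f] with [i0] or [i1]; the exclusive or rules out
   the pair of [i0] and [i1]. *)
have clU i j : (i == j) || ((i == f) (+) (j == f)) && (i \in pred3 i0 i1 f) && (j \in pred3 i0 i1 f) ->
    #|L i :|: L j| <= t.
  move=> ij; apply: omega_t; last by apply/subsetP => h; rewrite inE => /orP[]; exact: inL.
  apply/cliqueP => h h'.
  have main k l : (k == l) || ((k == f) (+) (l == f)) && (k \in pred3 i0 i1 f) && (l \in pred3 i0 i1 f) ->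
      h \in L k -> h' \in L l -> h != h' -> e h h'.
    rewrite !inE => kl Ck Cl neq.
    have := clC _ _ Ck Cl; rewrite xpair_eqE negb_and neq orbT => /(_ isT).
    rewrite /padded_join /= (negPf neq) /=.
    case: eqP kl => //= _ /andP[/andP[kl k3] l3].
    rewrite !inE k3 l3 /=.
    case: ifP => // /andP[k2 l2] _; move: kl.
    by case/orP: k2 => /eqP->; case/orP: l2 => /eqP->; rewrite ?(negPf neq0f) ?(negPf neq1f).
  rewrite !in_setU => /orP[] H /orP[] H'; apply: main H H' => //.
  - by rewrite eqxx.
  - by rewrite eq_sym addbC -andbA (andbC (j \in _)) andbA.
  - by rewrite eqxx.
have leL i : #|L i| <= t.
  by have := clU i i; rewrite eqxx setUid; exact.
have disj : L i0 :&: L i1 = set0.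
  apply/setP => h; rewrite !inE; apply/negP => /andP[C0 C1].
  have := clC _ _ C0 C1; rewrite xpair_eqE (negPf neq01) => /(_ isT).
  by rewrite /padded_join /= (negPf neq01) !inE !eqxx orbT.
have le0 : #|L i0 :|: L f| <= t.
  by apply: clU; rewrite (negPf neq0f) !inE !eqxx !orbT.
have le1 : #|L i1 :|: L f| <= t.
  by apply: clU; rewrite (negPf neq1f) !inE !eqxx !orbT.
(* The intersections of [L f] with [L i0] and [L i1] are disjoint, so together they cost at most
   [#|L f|] in the sum of [le0] and [le1]. *)
have three : #|L i0| + #|L i1| + #|L f| <= 2 * t.
  have c0 := cardsU (L i0) (L f); have c1 := cardsU (L i1) (L f).
  have : #|L i0 :&: L f| + #|L i1 :&: L f| <= #|L f|.
    have <- : #|(L i0 :&: L f) :|: (L i1 :&: L f)| = #|L i0 :&: L f| + #|L i1 :&: L f|.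
      by rewrite cardsU setIACA disj set0I cards0 subn0.
    by apply: subset_leq_card; rewrite subUset !subsetIr.
  have := subset_leq_card (subsetIl (L i0) (L f)).
  have := subset_leq_card (subsetIl (L i1) (L f)).
  by lia.
rewrite cC (bigD1 i0) //= (bigD1 i1) ?(eq_sym i1) //= (bigD1 f) /=; last first.
  by rewrite !(eq_sym f) neq0f neq1f.
pose P := [pred i | (i != i0) && (i != i1) && (i != f)].
have cP : #|P| + 3 = #|I|.
  have cPC : #|[predC P]| = #|[set i0; i1; f]|.
    by apply: eq_card => i; rewrite !inE !negb_and !negbK.
  rewrite -(cardC P) cPC.
  by rewrite -setUA cardsU1 cards2 neq1f !inE negb_or neq01 neq0f.
have leP : \sum_(i | P i) #|L i| <= #|P| * t.
  by rewrite -sum_nat_const; apply: leq_sum.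
have : #|I|.-1 * t = 2 * t + #|P| * t by rewrite -cP -mulnDl addnC; congr (_ * _); lia.
by move: leP three; rewrite /P /=; lia.
Qed.

(** Outside the filler copy, vertices differing in both coordinates are adjacent. Equal second
    coordinates are left out because of the missing edges between [i0] and [i1]. *)
Lemma padded_join_degree (A : {set T}) (D : {set I * T}) (x : I * T) :
  setX [set~ f] A \subset D -> x \in setX [set~ f] A ->
  #|I|.-2 * #|A|.-1 <= #|[set y in D | r x y]|.
Proof.
case: x => i h sD; rewrite inE /= => /andP[]; rewrite !inE => neqf Ah.
have -> : #|I|.-2 * #|A|.-1 = #|setX ([set~ f] :\ i) (A :\ h)|.
  have := cardsD1 h A; rewrite Ah => ->; rewrite cardsX; congr (_ * _).
  by have := cardsD1 i [set~ f]; rewrite cardsC1 !inE neqf; lia.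
apply: subset_leq_card; apply/subsetP => -[j h'].
rewrite !inE /= => /andP[/andP[neqi jf] /andP[neqh Ah']].
rewrite (subsetP sD) ?inE /= ?inE ?jf //.
rewrite /padded_join /= eq_sym (negPf neqi) (eq_sym h) neqh /=.
case: ifP => // /negbT low; case: ifP => // /andP[]; rewrite !inE.
rewrite (negPf neqf) (negPf jf) !orbF => i2 j2; move: low.
by rewrite !inE i2 j2.
Qed.

End PaddedJoin.

(** The [n] vertices are [q.-1] full copies of [A] and a filler copy of a part [S] of [A]. Of the
    gap of two below [k], the double fibre uses up one, and the other gives the strict
    inequality. *)
Lemma padded_join_graph (T : finType) (e : rel T) (A : {set T}) (q t k n : nat) :
  symmetric e -> irreflexive e -> 2 < q ->
  (forall C : {set T}, clique e C -> #|C| <= t) ->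
  (forall S : {set T}, S \subset A -> {in S &, forall x y, ~~ e x y} ->
     #|S| + 2 <= k) ->
  q.-1 * #|A| <= n <= q * #|A| ->
  exists G : sgraph 'I_n, [/\ forall C : {set 'I_n}, clique (adj G) C -> #|C| <= q.-1 * t,
    indep_num G < k & q.-1 * #|A| * (q.-2 * #|A|.-1) <= 2 * #|edges G|].
Proof.
move=> e_sym e_irr q_gt2 omega_t alpha_k /andP[le_n n_le].
have [i0 [i1 [f [neq01 neq0f neq1f]]]] : exists i0 i1 f : 'I_q, [/\ i0 != i1, i0 != f & i1 != f].
  by case: q q_gt2 {le_n n_le} => [|[|[|q]]] // _; exists (inord 0), (inord 1), (inord 2);
    rewrite -!val_eqE /= !inordK.
have [|S sSA cS] := @subset_of_card _ A (n - q.-1 * #|A|).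
  by rewrite leq_subLR -mulSnr prednK //; lia.
pose D := setX [set~ f] A :|: setX [set f] S.
have cD : #|D| = n.
  rewrite /D cardsU (_ : _ :&: _ = set0).
    by rewrite cards0 subn0 !cardsX cardsC1 card_ord cards1 mul1n cS subnKC.
  by apply/setP => -[i h]; rewrite !inE /=; case: (i == f); rewrite ?andbF.
have sDA x : x \in D -> x.2 \in A.
  by case: x => i h; rewrite !inE /= => /orP[/andP[]|/andP[_ /(subsetP sSA)]].
have r_sym := padded_join_sym i0 i1 f e_sym.
have r_irr := padded_join_irr i0 i1 f e_irr.
have [G [phi [phi_inj im_phi GP]]] := pullback_graph r_sym r_irr cD.
have phiD i : phi i \in D by rewrite -im_phi imset_f.
exists G; split.
- move=> C /cliqueP clC; rewrite -(card_imset _ phi_inj).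
  have := @padded_join_clique _ _ e i0 i1 f neq01 neq0f neq1f t (phi @: C).
  rewrite card_ord; apply; first by move=> B clB _; exact: omega_t.
  apply/cliqueP => _ _ /imsetP[x Cx ->] /imsetP[y Cy ->] neq.
  by rewrite -GP; apply: clC => //; apply: contra_neq neq => ->.
- have [W GW <-] := indep_num_attained G; rewrite -(card_imset _ phi_inj).
  have [|indL leL] := padded_join_indep e_irr neq01 (S := phi @: W) (i0 := i0) (i1 := i1) (f := f).
    move=> _ _ /imsetP[x Wx ->] /imsetP[y Wy ->]; rewrite -GP.
    by move/forall_inP: GW => /(_ x Wx)/forall_inP; apply.
  apply: (leq_ltn_trans leL).
  have sL : [set x.2 | x in phi @: W] \subset A.
    by apply/subsetP => _ /imsetP[_ /imsetP[x _ ->] ->]; exact: sDA.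
  by have := alpha_k _ sL indL; rewrite addn2.
rewrite edges_cliques -(sum_degrees (@adj_sym _ G) (@adj_irr _ G)).
have -> : \sum_x #|[set y | adj G x y]| = \sum_(w in D) #|[set w' in D | padded_join e i0 i1 f w w']|.
  rewrite -im_phi big_imset /=; last by move=> x y _ _; exact: phi_inj.
  apply: eq_big => [x|x _]; first by rewrite inE.
  rewrite -(card_imset _ phi_inj); congr (#|pred_of_set _|); apply/setP => w; rewrite !inE.
  apply/imsetP/andP => [[y]|[/imsetP[y _ ->]]]; rewrite ?inE.
    by move=> exy ->; rewrite imset_f // -GP.
  by rewrite -GP => exy; exists y; rewrite ?inE.
have -> : q.-1 * #|A| = #|setX [set~ f] A| by rewrite cardsX cardsC1 card_ord.
rewrite -sum_nat_const.
have sXD : setX [set~ f] A \subset D by exact: subsetUl.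
rewrite [X in _ <= X](big_setID (setX [set~ f] A)) /= (setIidPr sXD).
apply: leq_trans (leq_addr _ _); apply: leq_sum => w Xw.
by have := padded_join_degree e neq01 neq0f neq1f sXD Xw; rewrite card_ord.
Qed.

(** The extremal graph [H] for [Qnum t.+1 N] has no clique of order [p * 2], and by [leQ] its
    [m]-sets without a [p]-clique contain maximum independent sets. Hence [clique_in_large_set]
    applies, then [lower_indep_by_two], and [padded_join_graph] restores the order [n]. *)
Lemma near_turan_graph (p q s a m D t n N : nat) :
  1 < p -> 2 < q -> t.+1 <= p * 2 -> 0 < a ->
  4 * D <= 2 ^ a -> 4 * q <= D -> 4 * q <= N ->
  n <= q.-1 * N -> q.-1 * N < n + q.-1 -> n <= 2 ^ (s ^ q) ->
  p * q.-1 * m.+1 * 2 ^ (a * p.+1 * s ^ q.-1) <= n ->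
  1 < t.+1 -> Qnum t.+1 N <= Qnum p m ->
  exists (G : sgraph 'I_n) (N' : nat),
    [/\ forall C : {set 'I_n}, clique (adj G) C -> #|C| <= q.-1 * t,
      indep_num G < Qnum t.+1 N,
      D * N <= D * N' + 2 * D + 2 * N &
      q.-1 * N' * (q.-2 * N'.-1) <= 2 * #|edges G|].
Proof.
move=> p_gt1 q_gt2 letp a_gt0 leD leqD leqN lenN ltNn len ltm t_gt0 leQ.
have [H freeH indH] := Qnum_attained N t_gt0.
have e_sym := @adj_sym _ H; have e_irr := @adj_irr _ H.
have omegaH (C : {set 'I_N}) : clique (adj H) C -> #|C| <= t.
  move=> clC; rewrite leqNgt; apply/negP => /subset_of_card[B sBC cB].
  move/negP: freeH; apply; apply/contains_completeP.
  by exists B => //; exact: clique_sub clC.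
have alphaH (S : {set 'I_N}) : {in S &, forall x y, ~~ adj H x y} ->
    #|S| <= Qnum t.+1 N.
  move=> indS; rewrite -indH; apply: indep_num_ge.
  by apply/forall_inP => x Sx; apply/forall_inP => y; exact: indS.
have mk (U : {set 'I_N}) : m <= #|U| ->
    (forall A : {set 'I_N}, A \subset U -> clique (adj H) A -> #|A| <> p) ->
    exists S : {set 'I_N}, [/\ S \subset U, Qnum t.+1 N <= #|S| &
      {in S &, forall x y, ~~ adj H x y}].
  move=> /subset_of_card[V sVU cV] noclique.
  have [A sAV|S [sSV leS indS]] := @Qnum_rel _ _ p V e_sym e_irr.
    exact: noclique (subset_trans sAV sVU).
  exists S; split=> //; first exact: subset_trans sVU.
  by apply: leq_trans leQ _; rewrite -cV.
have p_gt0 := ltnW p_gt1.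
have large (U : {set 'I_N}) : p.-1 * m + 1 <= #|U| ->
    exists A : {set 'I_N}, [/\ A \subset U, #|A| = p & clique (adj H) A].
  by rewrite addn1; exact: (clique_in_large_set e_sym e_irr p_gt0 alphaH mk).
have q1_gt0 : 0 < q.-1 by lia.
have pow_gt0 : 0 < 2 ^ (a * p.+1 * s ^ q.-1) by rewrite expn_gt0.
(* With [s ^ q.-1] in place of [s], the bound [2 ^ (s ^ q.-1) ^ 2] still covers [N], since
   [q <= 2 * q.-1]. *)
have [||||||A [leA2 leA alphaA]] := @lower_indep_by_two _ _ p (s ^ q.-1) a
    (p.-1 * m + 1) D (Qnum t.+1 N) e_sym e_irr a_gt0 _ _ _ large _ leD _ _ alphaH.
- by rewrite addn1.
- rewrite card_ord; apply: (@leq_trans n).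
    rewrite leqNgt; apply/negP => ltnN.
    have : q.-1 * n.+1 <= q.-1 * N by rewrite leq_mul2l ltnN orbT.
    by have := leq_pmull n q1_gt0; rewrite mulnS; lia.
  apply: leq_trans len _; rewrite leq_pexp2l // -expnM.
  case: (posnP s) => [->|s_gt0]; first by rewrite !exp0n //; lia.
  by rewrite leq_pexp2l //; lia.
- rewrite card_ord -(ltn_pmul2l q1_gt0); apply: leq_trans lenN; apply: leq_trans ltm.
  rewrite mulnA ltn_pmul2r // [(p * _)]mulnC -mulnA ltn_pmul2l //; nia.
- move=> C /omegaH leC cC; lia.
- by lia.
- by rewrite card_ord; lia.
rewrite card_ord in leA2 leA.
have [||G [clG indG eG]] := @padded_join_graph _ _ A q t (Qnum t.+1 N) n e_sym e_irr q_gt2 omegaH.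
- by move=> S sSA indS; exact: alphaA.
(* Losing two vertices per copy absorbs the rounding of [N]. The loss per copy, at most
   [2 + 2 * N / D], is at most [N / q], so one filler copy suffices. *)
- apply/andP; split.
    have : q.-1 * (#|A| + 2) <= q.-1 * N by rewrite leq_mul2l leA2 orbT.
    by rewrite mulnDr; lia.
  apply: leq_trans lenN _; rewrite -(@leq_pmul2l D); last by lia.
  have qE : q = q.-1.+1 by lia.
  have : q * (D * N) <= q * (D * #|A| + 2 * D + 2 * N) by rewrite leq_mul2l leA orbT.
  have : 4 * q * N <= D * N by rewrite leq_mul2r leqD orbT.
  have : D * (4 * q) <= D * N by rewrite leq_mul2l leqN orbT.
  by rewrite {3 4 5}qE; lia.
by exists G, #|A|.
Qed.

(* Supersaturation of cliques *)
From mathcomp Require Import all_classical all_reals all_analysis.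
From mathcomp Require Import ring lra.
Import Order.TTheory GRing.Theory Num.Theory.
Import numFieldNormedType.Exports.
Local Open Scope classical_set_scope.
Local Open Scope ring_scope.

(** Induction on [r] through [moon_moser]; [1 - sigma] stands for the edge density, and positivity
    of the factors keeps the clique counts nonzero. *)
Lemma cliques_ratio (R : realFieldType) (T : finType) (e : rel T) (sigma : R)
    (q : nat) :
  symmetric e -> irreflexive e -> (0 < #|T|)%N ->
  (forall r, (0 < r < q)%N -> 0 < 1 - r%:R * sigma) ->
  (1 - sigma) * #|T|%:R ^+ 2 <= 2 * #|cliques e 2|%:R ->
  forall r, (0 < r < q)%N ->
    (0 < #|cliques e r|)%N /\
    (1 - r%:R * sigma) * #|T|%:R * #|cliques e r|%:R
      <= r.+1%:R * #|cliques e r.+1|%:R.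
Proof.
move=> e_sym e_irr T_gt0 sigmaP dense.
have n_gt0 : 0 < #|T|%:R :> R by rewrite ltr0n.
elim=> [//|[_ _|r IHr ltr]].
  by rewrite card_cliques1 mul1r -mulrA -expr2; split.
have [|k_gt0 IH] := IHr; first by lia.
have s_gt0 : 0 < 1 - r.+1%:R * sigma by apply: sigmaP; lia.
have k1_gt0 : (0 < #|cliques e r.+2|)%N.
  rewrite -(ltr0n R) -(pmulr_rgt0 _ (ltr0Sn _ r.+1)).
  by apply: lt_le_trans IH; rewrite !mulr_gt0 // ltr0n.
split=> //.
have := moon_moser r.+1 e_sym e_irr.
rewrite -(ler_nat R) natrX !natrM natrD !natrM.
move: k_gt0 k1_gt0 IH; rewrite -!(ltr0n R).
move: #|cliques e r.+1|%:R #|cliques e r.+2|%:R #|cliques e r.+3|%:R => x y z.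
move: n_gt0; have -> : r.+2%:R = r.+1%:R + 1 :> R by rewrite natr1.
have -> : r.+3%:R = r.+1%:R + 2 :> R by rewrite -natrD addn2.
have : 0 < r.+1%:R :> R by rewrite ltr0n.
move: #|T|%:R r.+1%:R s_gt0 => n c s_gt0 c_gt0 n_gt0 x_gt0 y_gt0 IH mm.
rewrite -(ler_pM2l c_gt0) -(ler_pM2l x_gt0).
(* One factor of the square is replaced by its lower bound [IH]. After cancelling [x], the identity
   [(c + 1) * (1 - c * sigma) - 1 = c * (1 - (c + 1) * sigma)] closes the induction. *)
have : (1 - c * sigma) * n * x * ((c + 1) * y) <= ((c + 1) * y) ^+ 2.
  by rewrite expr2 ler_wpM2r // mulr_ge0 // ?addr_ge0 // ltW.
nra.
Qed.

Lemma supersaturation (R : realType) (q : nat) (eps : R) :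
  (1 < q)%N -> 0 < eps ->
  exists2 a : nat, (0 < a)%N &
    forall (T : finType) (e : rel T), symmetric e -> irreflexive e ->
    (2^-1 * (1 - (q - 1)%N%:R^-1) + eps) * #|T|%:R ^+ 2
      <= #|cliques e 2|%:R :> R ->
    (#|T| ^ q <= 2 ^ a * #|cliques e q|)%N.
Proof.
move=> q_gt1 eps_gt0.
pose c : R := 2 * eps / q%:R.
have q_gt0 : 0 < q%:R :> R by rewrite ltr0n; lia.
have c_gt0 : 0 < c by rewrite divr_gt0 // mulr_gt0.
have [a leac] : exists a : nat, (c ^+ q.-1)^-1 <= 2 ^+ a.
  have [a lea] : exists a : nat, (c ^+ q.-1)^-1 <= a%:R.
    exists (Num.truncn (c ^+ q.-1)^-1).+1; apply/ltW/truncnS_gt.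
  exists a; apply: le_trans lea _.
  by rewrite -natrX ler_nat ltnW // ltn_expl.
exists a.+1 => // T e e_sym e_irr dense.
have [->|T_gt0] := posnP #|T|; first by rewrite exp0n //; lia.
have q1_gt0 : 0 < (q - 1)%N%:R :> R by rewrite ltr0n; lia.
(* With this [sigma] every factor [1 - r%:R * sigma] with [0 < r < q] is at least [2 * eps];
   bounding [r.+1] by [q] gives the uniform ratio [c]. *)
pose sigma : R := (q - 1)%N%:R^-1 - 2 * eps.
have sigmaP r : (0 < r < q)%N -> 2 * eps <= 1 - r%:R * sigma.
  move=> /andP[r_gt0 ltrq]; rewrite /sigma mulrBr.
  have : r%:R * (q - 1)%N%:R^-1 <= 1 :> R.
    by rewrite ler_pdivrMr // mul1r ler_nat; lia.
  have : 1 <= r%:R :> R by rewrite ler1n.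
  nra.
have ratio r : (0 < r < q)%N -> c * #|T|%:R * #|cliques e r|%:R <= #|cliques e r.+1|%:R.
  move=> rq; have [|| _] := @cliques_ratio R T e sigma q e_sym e_irr T_gt0 _ _ r rq.
  - by move=> r' /sigmaP; apply: lt_le_trans; rewrite mulr_gt0.
  - by move: dense; rewrite /sigma; nra.
  move=> le1; rewrite -(ler_pM2l q_gt0).
  apply: (@le_trans _ _ (r.+1%:R * #|cliques e r.+1|%:R)); last first.
    by rewrite ler_wpM2r // ler_nat; case/andP: rq.
  apply: le_trans le1; have -> : q%:R * (c * #|T|%:R * #|cliques e r|%:R)
      = 2 * eps * #|T|%:R * #|cliques e r|%:R.
    by rewrite /c; field; rewrite gt_eqF.
  by rewrite ler_wpM2r // ler_wpM2r // sigmaP.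
have count r : (r < q)%N -> c ^+ r * #|T|%:R ^+ r.+1 <= #|cliques e r.+1|%:R.
  elim: r => [_|r IHr ltr]; first by rewrite card_cliques1 mul1r.
  apply: le_trans (ratio r.+1 _); last by lia.
  rewrite exprS [_ ^+ r.+2]exprS mulrACA ler_wpM2l ?IHr //; last exact: ltnW.
  by rewrite mulr_ge0 // ltW.
have := count q.-1; rewrite prednK ?(ltnW q_gt1) // => /(_ (leqnn _)).
rewrite -(ler_nat R) natrM !natrX => countq.
have cq_gt0 : 0 < c ^+ q.-1 by rewrite exprn_gt0.
have : #|T|%:R ^+ q <= 2 ^+ a * #|cliques e q|%:R :> R.
  apply: le_trans (_ : (c ^+ q.-1)^-1 * #|cliques e q|%:R <= _).
    by rewrite ler_pdivlMl.
  by rewrite ler_wpM2r.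
by move=> /le_trans; apply; rewrite ler_wpM2r // exprS ler_peMl // ?exprn_ge0 // ler1n.
Qed.

(** * Asymptotics *)

Lemma log2K (R : realType) (x : R) : 0 < x -> 2 `^ log2 x = x.
Proof.
move=> x_gt0; rewrite /log2 /powR pnatr_eq0 /= mulfVK ?lnK //.
by rewrite gt_eqF // ln_gt0 // ltr1n.
Qed.

Lemma natr_pow2 (R : realType) (k : nat) : (2 ^ k)%:R = 2 `^ k%:R :> R.
Proof. by rewrite natrX powR_mulrn. Qed.

Lemma absz_ceil_bound (R : realType) (x : R) : 0 <= x ->
  x <= `|Num.ceil x|%:R < x + 1.
Proof.
move=> x_ge0; rewrite natr_absz ger0_norm; last first.
  by rewrite ceil_ge0 (lt_le_trans _ x_ge0) // ltrN10.
have /andP[] := ceil_itv x; rewrite intrB => ltx ->.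
by rewrite -ltrBlDr.
Qed.

(* The witness [s] is [(log n)^(1/q)] rounded up. *)
Lemma fomega_asymptotics (R : realType) (q A C : nat) (omega : nat -> R) :
  (1 < q)%N -> omega n @[n --> \oo] --> +oo ->
  \forall n \near \oo,
    exists s : nat, [/\ (n <= 2 ^ (s ^ q))%N,
      (0 < `|Num.ceil (fomega q omega n)|)%N &
      (C * `|Num.ceil (fomega q omega n)|.+1 * 2 ^ (A * s ^ q.-1) <= n)%N].
Proof.
move=> q_gt1 omega_oo.
(* As [s] is at most twice [(log n)^(1/q)], the exponent [A * s ^ q.-1] is at most [B] times [P],
   that is [(log n)^(1-1/q)]. The constant [c] satisfies [4 * C <= 2 ^ c]. *)
pose B := (A * 2 ^ q.-1)%N.
pose c := (4 * C)%N.
have [N0 _ N0P] : \forall n \near \oo, (B + c)%:R <= omega n.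
  by move/cvgryPge : omega_oo; exact.
exists (N0 + 2 ^ ((B + c) ^ q) + 2)%N => // n /= len.
have {N0P} le_omega : (B + c)%:R <= omega n by apply: N0P => /=; lia.
have le_n : (2 ^ ((B + c) ^ q) <= n)%N by lia.
have q1_gt0 : (0 < q.-1)%N by rewrite -subn1 subn_gt0.
have n_ge2 : (2 <= n)%N by lia.
have q_neq0 : q%:R != 0 :> R by rewrite pnatr_eq0; lia.
have two_ge1 : 1 <= 2 :> R by rewrite ler1n.
have n_gt0 : 0 < n%:R :> R by rewrite ltr0n; lia.
pose L : R := log2 n%:R.
have n_def : n%:R = 2 `^ L :> R by rewrite log2K.
have ln2_gt0 : 0 < ln 2 :> R by rewrite ln_gt0 // ltr1n.
have le_log2 (k : nat) : (2 ^ k <= n)%N -> k%:R <= L.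
  rewrite -(ler_nat R) natr_pow2 => lek; rewrite /L /log2 ler_pdivlMr //.
  by rewrite -ln_powR ler_ln // posrE // powR_gt0.
have L_ge1 : 1 <= L by apply: (le_log2 1%N).
pose y : R := L `^ q%:R^-1.
have y_ge0 : 0 <= y by exact: powR_ge0.
have yq : y ^+ q = L.
  by rewrite -powR_mulrn // -powRrM mulVf // powRr1 // (le_trans ler01).
have y_ge1 : 1 <= y.
  by rewrite -(@ler_pXn2r _ q) ?nnegrE //; [rewrite expr1n yq|lia].
have y_geBc : (B + c)%:R <= y.
  by rewrite -(@ler_pXn2r _ q) ?nnegrE //; [rewrite yq -natrX le_log2|lia].
pose P : R := y ^+ q.-1.
have PE : L `^ (1 - q%:R^-1) = P.
  rewrite /P -powR_mulrn // -powRrM; congr (_ `^ _).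
  have -> : q.-1%:R = q%:R - 1 :> R by rewrite -subn1 natrB // ltnW.
  by rewrite mulrBr mulVf // mulr1.
have P_ge1 : 1 <= P by rewrite exprn_ege1.
have PyL : P * y = L by rewrite -yq -exprSr prednK // ltnW.
pose f := fomega q omega n; pose m := `|Num.ceil f|%N.
have f_gt0 : 0 < f by rewrite mulr_gt0 // powR_gt0.
have /andP[lef ltm] : f <= m%:R < f + 1 by exact: absz_ceil_bound (ltW f_gt0).
rewrite -/f -/m; move: m lef ltm => m lef ltm.
have [s les s_le2y] : exists2 s : nat, y <= s%:R & s%:R <= 2 * y.
  have /andP[les lts] := absz_ceil_bound y_ge0.
  by exists `|Num.ceil y|%N => //; lra.
exists s; split.
- rewrite -(ler_nat R) natr_pow2 n_def ler_powR // -yq natrX.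
  by rewrite ler_pXn2r ?nnegrE // ltnW.
- by rewrite -(ltr0n R); apply: lt_le_trans lef.
have pow_le : (2 ^ (A * s ^ q.-1))%:R <= 2 `^ (B%:R * P).
  rewrite natr_pow2 ler_powR // /B !natrM !natrX -mulrA ler_wpM2l //.
  by rewrite -exprMn ler_pXn2r ?nnegrE ?mulr_ge0.
have C_le : (4 * C%:R : R) <= 2 `^ c%:R.
  by rewrite -natr_pow2 -natrM ler_nat ltnW // ltn_expl.
have f_le : f * 2 `^ (B%:R * P) * (4 * C%:R) <= n%:R.
  apply: (@le_trans _ _ (f * 2 `^ (B%:R * P) * 2 `^ c%:R)).
    by rewrite ler_wpM2l // mulr_ge0 ?powR_ge0 // ltW.
  rewrite /f /fomega -!mulrA ger_pMr // -!powRD ?pnatr_eq0 ?implybT //.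
  rewrite -[leRHS](powRr0 2) ler_powR // PE.
  move: le_omega; rewrite natrD => le_omega.
  have : (B%:R + c%:R) * P <= omega n * P by rewrite ler_wpM2r // (le_trans ler01).
  have : c%:R <= c%:R * P by rewrite ler_peMr.
  lra.
have pow_le_n : 2 `^ (B%:R * P) * (4 * C%:R) <= n%:R.
  apply: (@le_trans _ _ (2 `^ (B%:R * P) * 2 `^ c%:R)).
    by rewrite ler_wpM2l // powR_ge0.
  rewrite n_def -powRD ?pnatr_eq0 ?implybT // ler_powR // -PyL.
  have : (B + c)%:R * P <= y * P by rewrite ler_wpM2r // (le_trans ler01).
  have : c%:R <= c%:R * P by rewrite ler_peMr.
  rewrite natrD; lra.
rewrite -(ler_nat R) !natrM -natr1.
have E_ge0 := powR_ge0 2 (B%:R * P).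
(* Rounding up and the successor cost at most 2; by [f_le] and [pow_le_n] the terms with [f] and
   with 2 are at most [n / 4] and [n / 2]. *)
apply: (@le_trans _ _ (C%:R * (f + 2) * 2 `^ (B%:R * P))).
  apply: ler_pM => //.
  by rewrite ler_wpM2l //; lra.
lra.
Qed.

(** * The two bounds on the density *)

(** Denser graphs have [n ^ q / 2 ^ a] cliques of order [q] by supersaturation, hence a clique of
    order [p * q]. Allowing any [r <= p * q] and any smaller [g] covers (a) and the upper half of
    (b). *)
Lemma RTdensity_le (R : realType) (p q r : nat) (omega g : nat -> R) (eps : R) :
  (1 < q)%N -> (r <= p * q)%N -> omega n @[n --> \oo] --> +oo -> 0 < eps ->
  (\forall n \near \oo, g n <= (Qreal p (fomega q omega n))%:R) ->
  \forall n \near \oo, (RTdensity (complete r) g n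
    <= (2^-1 * (1 - (q - 1)%N%:R^-1) + eps)%:E)%E.
Proof.
move=> q_gt1 lerpq omega_oo eps_gt0 gQ.
have [a a_gt0 satP] := @supersaturation R q eps q_gt1 eps_gt0.
near=> n.
have gQn : g n <= (Qreal p (fomega q omega n))%:R by near: n.
have [s [len m_gt0 ltm]] : exists s : nat, [/\ (n <= 2 ^ (s ^ q))%N,
      (0 < `|Num.ceil (fomega q omega n)|)%N &
      (1 * `|Num.ceil (fomega q omega n)|.+1 * 2 ^ (a * p.+1 * s ^ q.-1) <= n)%N].
  by near: n; apply: fomega_asymptotics.
move: gQn; rewrite /Qreal; set m := `|_|%N in m_gt0 ltm *; move=> gQn.
have n_gt0 : 0 < n%:R :> R.
  by rewrite ltr0n; apply: leq_trans ltm; rewrite mul1n muln_gt0 expn_gt0.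
rewrite /RTdensity lee_fin ler_pdivrMr ?exprn_gt0 // /RT.
have c_ge0 : 0 <= (2^-1 * (1 - (q - 1)%N%:R^-1) + eps) * n%:R ^+ 2.
  have : (q - 1)%N%:R^-1 <= 1 :> R by rewrite invf_le1 ?ler1n ?ltr0n; lia.
  by move=> le1; rewrite mulr_ge0 ?exprn_ge0 //; lra.
apply: (big_ind (fun k : nat => k%:R <= (2^-1 * (1 - (q - 1)%N%:R^-1) + eps) * n%:R ^+ 2)) => //.
  by move=> x y; rewrite /maxn; case: ifP.
move=> G /andP[freeG indG]; rewrite leNgt; apply/negP => /ltW many.
have ltQ : (indep_num G < Qnum p m)%N by rewrite -(ltr_nat R) (lt_le_trans indG).
move: many; rewrite edges_cliques -{1}(card_ord n) => /satP.
move=> /(_ (@adj_sym _ G) (@adj_irr _ G)) many.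
have [|||C cC clC] := clique_multiple (@adj_sym _ G) (@adj_irr _ G) a_gt0 m_gt0 _ _ _ many (s := s) (p := p).
- by rewrite card_ord.
- rewrite card_ord; apply: leq_trans ltm.
  by rewrite mul1n ltn_pmul2r // expn_gt0.
- by move=> U; exact: small_indep_clique ltQ.
move: freeG => /negP; apply; apply/contains_completeP.
have [|B sBC cB] := @subset_of_card _ C r; first by rewrite cC.
by exists B; last exact: clique_sub clC.
Unshelve. all: by end_near.
Qed.

Lemma limn_esup_le (R : realType) (u : nat -> \bar R) (c : R) :
  (forall eps, 0 < eps -> \forall n \near \oo, (u n <= (c + eps)%:E)%E) ->
  (limn_esup u <= c%:E)%E.
Proof.
move=> uc; apply/lee_addgt0Pr => eps eps_gt0.
have uV := uc eps eps_gt0.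
(* The limsup is an infimum of suprema over the sets of the filter, and the set where the bound
   holds is one of them. *)
apply: (@le_trans _ _ (ereal_sup (u @` [set n | (u n <= (c + eps)%:E)%E]))).
  by apply: ereal_inf_lbound; exists [set n | (u n <= (c + eps)%:E)%E].
by apply: ge_ereal_sup => _ [n /= un <-]; rewrite -EFinD.
Qed.

Lemma limn_einf_ge (R : realType) (u : nat -> \bar R) (c : R) :
  (forall eps, 0 < eps -> \forall n \near \oo, ((c - eps)%:E <= u n)%E) ->
  (c%:E <= limn_einf u)%E.
Proof.
move=> uc; rewrite /limn_einf leeNr -EFinN; apply: limn_esup_le => eps eps_gt0.
have := uc eps eps_gt0; apply: filterS => n.
by rewrite leeNl -EFinN opprD opprK.
Qed.

Lemma RTdensity_ge (R : realType) (p q r t : nat) (omega g : nat -> R) (eps : R) :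
  (1 < p)%N -> (2 < q)%N -> (0 < t)%N -> (t.+1 <= p * 2)%N -> (q.-1 * t < r)%N ->
  omega n @[n --> \oo] --> +oo -> 0 < eps -> eps < 1 ->
  (\forall n \near \oo,
     (Qreal t.+1 (n%:R / (q - 1)%N%:R : R))%:R <= g n
     /\ g n <= (Qreal p (fomega q omega n))%:R) ->
  \forall n \near \oo, ((2^-1 * (1 - (q - 1)%N%:R^-1) - eps)%:E
    <= RTdensity (complete r) g n)%E.
Proof.
move=> p_gt1 q_gt2 t_gt0 letp ltr omega_oo eps_gt0 eps_lt1 gQ.
(* The second summand makes the relative loss [2 / D] at most [eps / 2]. *)
pose D := (4 * q + (Num.truncn (4 / eps)).+1)%N.
have leD : 4 <= eps * D%:R.
  rewrite -ler_pdivrMl // mulrC ltW // (lt_le_trans (truncnS_gt _)) //.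
  by rewrite ler_nat leq_addl.
pose a := (4 * D)%N.
have lea : (4 * D <= 2 ^ a)%N by rewrite ltnW // ltn_expl.
have a_gt0 : (0 < a)%N by rewrite /a /D; lia.
near=> n.
have [Qg gQn] : (Qreal t.+1 (n%:R / (q - 1)%N%:R : R))%:R <= g n
     /\ g n <= (Qreal p (fomega q omega n))%:R by near: n.
have [s [len _ ltm]] : exists s : nat, [/\ (n <= 2 ^ (s ^ q))%N,
      (0 < `|Num.ceil (fomega q omega n)|)%N &
      (p * q.-1 * `|Num.ceil (fomega q omega n)|.+1 * 2 ^ (a * p.+1 * s ^ q.-1) <= n)%N].
  by near: n; apply: fomega_asymptotics => //; exact: ltnW.
have n_big : (4 * q * q <= n)%N by near: n; exists (4 * q * q)%N.
have n_big' : ((Num.truncn (8 * q%:R / eps)).+1 <= n)%N.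
  by near: n; exists (Num.truncn (8 * q%:R / eps)).+1.
have {n_big'} n_eps : 8 * q%:R <= eps * n%:R.
  rewrite -ler_pdivrMl // mulrC ltW // (lt_le_trans (truncnS_gt _)) //.
  by rewrite ler_nat.
have q1_pos : (0 < q.-1)%N by rewrite -subn1 subn_gt0 ltnW.
have q2_pos : (0 < q.-2)%N by rewrite -subn2 subn_gt0.
have qK : q.-1.+1 = q by rewrite prednK // ltnW // ltnW.
have D_pos : (0 < D)%N by rewrite /D addn_gt0 orbT.
have q1_gt0 : 0 < (q - 1)%N%:R :> R by rewrite ltr0n subn1.
have n_gt0 : 0 < n%:R :> R by rewrite ltr0n; lia.
move: Qg gQn ltm; rewrite /Qreal.
have /andP[] := @absz_ceil_bound R (n%:R / (q - 1)%N%:R) (divr_ge0 (ltW n_gt0) (ltW q1_gt0)).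
move: (`|Num.ceil (_ / _)|%N) (`|Num.ceil (fomega _ _ _)|%N) => N m.
rewrite -ltrBlDr ltr_pdivlMr // ler_pdivrMr // mulrBl mul1r ltrBlDr -natrD -!natrM ltr_nat ler_nat.
rewrite !(mulnC N) subn1 => lenN ltNn Qg gQn ltm.
have [||||G [N' [clG indG leN' eG]]] := @near_turan_graph p q s a m D t n N
    p_gt1 q_gt2 letp a_gt0 lea _ _ lenN ltNn len ltm _ _.
- by rewrite /D leq_addr.
- rewrite -(@leq_pmul2l q.-1) //.
  apply: leq_trans lenN; apply: leq_trans n_big; rewrite mulnC leq_mul2l leq_pred.
  by rewrite orbT.
- by [].
- by rewrite -(ler_nat R) (le_trans Qg).
have ltRT : (#|edges G| <= RT n (complete r) (g n))%N.
  apply: (@leq_bigmax_cond _ (fun G : sgraph 'I_n => graph_free (complete r) G && ((indep_num G)%:R < g n)) (fun G => #|edges G|)).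
  rewrite (lt_le_trans _ Qg) ?ltr_nat // andbT; apply/contains_completeP => -[C cC /clG].
  by rewrite cC leqNgt ltr.
rewrite /RTdensity lee_fin ler_pdivlMr ?exprn_gt0 //.
apply: (@le_trans _ _ #|edges G|%:R); last by rewrite ler_nat.
pose x : R := q.-1%:R * N'%:R.
have Q1_gt0 : 0 < q.-1%:R :> R by rewrite ltr0n.
have qE : q%:R = q.-1%:R + 1 :> R by rewrite natr1 qK.
have q2E : q.-2%:R = q.-1%:R - 1 :> R by rewrite -(subn1 q.-1) natrB.
(* Here [x] counts the vertices in [q.-1] copies. Half of [eps] pays for the loss [2 / D], the other
   half, as [8 * q <= eps * n], for the additive constants. *)
have lex : (1 - eps) * n%:R <= x - q.-1%:R.
  have D_gt0 : 0 < D%:R :> R by rewrite ltr0n.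
  have lenN' : n%:R <= q.-1%:R * N%:R :> R by rewrite -natrM ler_nat.
  have ltNn' : q.-1%:R * N%:R <= n%:R + q.-1%:R :> R by rewrite -natrM -natrD ler_nat ltnW.
  have : D%:R * N%:R <= D%:R * N'%:R + 2 * D%:R + 2 * N%:R :> R.
    by rewrite -!natrM -!natrD ler_nat.
  rewrite -(ler_pM2l Q1_gt0) => leN1.
  have leN2 : D%:R * n%:R <= D%:R * x + 2 * D%:R * q.-1%:R + 2 * (n%:R + q.-1%:R).
    by rewrite /x; nra.
  have : 2 * (n%:R + q.-1%:R) <= D%:R * (eps / 2 * (n%:R + q.-1%:R)).
    have : 0 <= n%:R + q.-1%:R :> R by rewrite addr_ge0.
    by nra.
  move=> leN3; have {leN2 leN3} : D%:R * n%:R <= D%:R * (x + 2 * q.-1%:R + eps / 2 * (n%:R + q.-1%:R)).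
    by nra.
  rewrite ler_pM2l //; nra.
have x_ge : (1 - eps) * n%:R <= x by lra.
have y_ge0 : 0 <= (1 - eps) * n%:R by rewrite mulr_ge0 ?subr_ge0 // ltW.
have N'_gt0 : (0 < N')%N.
  rewrite lt0n; apply/eqP => N'0; move: lex; rewrite /x N'0 mulr0; lra.
move: eG; rewrite -(ler_nat R) !natrM q2E => eG.
have N'E : N'.-1%:R = N'%:R - 1 :> R by rewrite -subn1 natrB.
have {eG} : (q.-1%:R - 1) * (x * (x - q.-1%:R)) <= 2 * #|edges G|%:R * q.-1%:R.
  by rewrite -(ler_pM2r Q1_gt0) in eG; apply: le_trans eG; rewrite N'E /x; lra.
have Q1_ge1 : 1 <= q.-1%:R :> R by rewrite ler1n.
have : ((1 - eps) * n%:R) ^+ 2 <= x * (x - q.-1%:R).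
  by rewrite expr2 ler_pM.
move=> le1 le2.
have le3 : (q.-1%:R - 1) * ((1 - eps) * n%:R) ^+ 2 <= 2 * #|edges G|%:R * q.-1%:R.
  by apply: le_trans le2; rewrite ler_wpM2l // subr_ge0.
have -> : (2^-1 * (1 - q.-1%:R^-1) - eps) * n%:R ^+ 2
  = ((q.-1%:R - 1) * (1 - 2 * eps) * n%:R ^+ 2 - 2 * eps * n%:R ^+ 2) / (2 * q.-1%:R).
  by field; rewrite gt_eqF.
rewrite ler_pdivrMr ?mulr_gt0 //.
have n2_ge0 : 0 <= n%:R ^+ 2 :> R by rewrite exprn_ge0.
have : (q.-1%:R - 1) * ((1 - 2 * eps) * n%:R ^+ 2) <= (q.-1%:R - 1) * ((1 - eps) * n%:R) ^+ 2.
  rewrite ler_wpM2l ?subr_ge0 // exprMn ler_wpM2r //; nra.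
have : 0 <= eps * n%:R ^+ 2 by rewrite mulr_ge0 // ltW.
lra.
Unshelve. all: by end_near.
Qed.

Theorem theorem3p4 (R : realType) (p q : nat) (omega : nat -> R)
    (hp : (2 <= p)%N) (hq : (2 <= q)%N)
    (homega : omega n @[n --> \oo] --> +oo) :
  (rhotau_sup (complete (p * q))
     (fun n => (Qreal p (fomega q omega n))%:R : R)
   <= (2^-1 * (1 - (q - 1)%N%:R^-1))%:E)%E
  /\
  (forall i : nat, (i <= p - 1)%N ->
     let t := ((p * q - i - 1) %/ (q - 1))%N in
     (p <= t)%N /\
     forall g : nat -> R,
       (\forall n \near \oo,
          (Qreal t.+1 (n%:R / (q - 1)%N%:R : R))%:R <= g n
          /\ g n <= (Qreal p (fomega q omega n))%:R) ->
       rhotau_is (complete (p * q - i)) g (2^-1 * (1 - (q - 1)%N%:R^-1))).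
Proof.
split.
  apply: limn_esup_le => eps eps_gt0.
  by apply: RTdensity_le homega eps_gt0 _ => //; exact: nearW.
move=> i lei t.
have pq : (p * q = p * (q - 1) + p)%N by rewrite subn1 -mulnSr prednK // ltnW.
have q1_gt0 : (0 < q - 1)%N by rewrite subn_gt0.
have lept : (p <= t)%N by rewrite leq_divRL // pq; lia.
split=> // g gQ.
(* The clique number [q.-1 * t] of the padded join must stay below [p * q - i], and [t] is the
   largest integer allowing this. *)
have ltr : (q.-1 * t < p * q - i)%N.
  have := leq_divM (p * q - i - 1) (q - 1).
  by rewrite -/t -subn1 (mulnC _ t) pq; lia.
have letp : (t.+1 <= p * 2)%N.
  rewrite /t ltn_divLR // -mulnA (mulnCA p 2) pq.
  by have := leq_pmulr p q1_gt0; lia.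
set c := 2^-1 * _.
have le_c : (rhotau_sup (complete (p * q - i)) g <= c%:E)%E.
  apply: limn_esup_le => eps eps_gt0.
  apply: RTdensity_le homega eps_gt0 _ => //; first exact: leq_subr.
  by apply: filterS gQ => n [].
have c_le : (c%:E <= rhotau_inf (complete (p * q - i)) g)%E.
  apply: limn_einf_ge => eps eps_gt0.
  (* The padded join needs three distinct indices; for [q = 2] the claimed density is 0 and the
     bound is trivial. *)
  have [q_gt2|q_le2] := ltnP 2 q.
    pose d := Num.min eps 2^-1.
    have d_gt0 : 0 < d by rewrite lt_min eps_gt0 invr_gt0 ltr0n.
    have d_lt1 : d < 1 by rewrite gt_min invf_lt1 ?ltr1n ?ltr0n ?orbT.
    have t_gt0 : (0 < t)%N by apply: leq_trans lept; exact: ltnW.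
    have := RTdensity_ge hp q_gt2 t_gt0 letp ltr homega d_gt0 d_lt1 gQ.
    apply: filterS => n; apply: le_trans.
    by rewrite lee_fin lerB // ge_min lexx.
  apply: nearW => n.
  have dens_ge0 : (0%:E <= RTdensity (complete (p * q - i)) g n)%E.
    by rewrite /RTdensity lee_fin divr_ge0 ?exprn_ge0.
  apply: le_trans dens_ge0; rewrite lee_fin /c (_ : q = 2%N); last first.
    by apply/eqP; rewrite eqn_leq q_le2.
  by rewrite subn1 invr1 subrr mulr0 sub0r oppr_le0 ltW.
have le_is := limn_einf_sup (RTdensity (complete (p * q - i)) g).
split; apply/eqP; rewrite eq_le.
  by rewrite le_c (le_trans c_le).
by rewrite c_le (le_trans le_is).
Qed.
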